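(* Let $p\ge1$ and assume that there exist constants $a>0$, $K_1\ge1$ and $K_2\ge1$ such that $$\mathbb E\big[\exp\big(a(G_{X_1}(X_1))^p\big)\big]\le K_1\quad\text{and}\quad\mathbb E\big[\exp\big(a(G_\varepsilon(\varepsilon))^p\big)\big]\le K_2.$$ Then there exist positive constants $A,B$ and $C_0$, not depending on $n$ and $x$, such that for all $n\ge1$ $$\mathbb P\Big(\big|W_1(\mu_n,\mu)-\mathbb E[W_1(\mu_n,\mu)]\big|>x\Big)\le\begin{cases}2\exp(-nAx^p)&\text{if }x\ge C_0,\\2\exp(-nBx^2)&\text{if }x\in[0,C_0].\end{cases}$$
   Context: $(\mathcal X,d)$ and $(\mathcal Y,\delta)$ are complete separable metric spaces; $(\varepsilon_i)_{i\ge1}$ is a sequence of iid $\mathcal Y$-valued random variables; $X_1$ is an $\mathcal X$-valued random variable independent of $(\varepsilon_i)_{i\ge2}$. The Markov chain is $X_n=F(X_{n-1},\varepsilon_n)$ for $n\ge2$, where $F:\mathcal X\times\mathcal Y\to\mathcal X$ is measurable and satisfies, for some $\rho\in[0,1)$ and $C>0$, $\mathbb E[d(F(x,\varepsilon_1),F(x',\varepsilon_1))]\le\rho\,d(x,x')$ for all $x,x'\in\mathcal X$, and $d(F(x,y),F(x,y'))\le C\,\delta(y,y')$ for all $x\in\mathcal X$, $y,y'\in\mathcal Y$. $\mu$ denotes the unique invariant distribution of the chain and $\mu_n=\frac1n\sum_{k=1}^n\delta_{X_k}$ the empirical distribution (here $\delta_{X_k}$ is a Dirac mass). $G_{X_1}(x)=\int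 d(x,x')P_{X_1}(dx')$ and $G_\varepsilon(y)=\int C\,\delta(y,y')P_\varepsilon(dy')$, where $P_{X_1}$ is the law of $X_1$ and $P_\varepsilon$ the common law of the $\varepsilon_k$'s; $G_\varepsilon(\varepsilon)$ denotes a random variable distributed as $G_\varepsilon(\varepsilon_k)$. For probability measures $\nu_1,\nu_2$ on $(\mathcal X,d)$, $W_1(\nu_1,\nu_2)=\inf_{\lambda\in M(\nu_1,\nu_2)}\int d(x,y)\,\lambda(dx,dy)$, where $M(\nu_1,\nu_2)$ is the set of probability measures on $\mathcal X\times\mathcal X$ with margins $\nu_1$ and $\nu_2$. *)

(* Defs.v *)
From HB Require Import structures.
From mathcomp Require Import all_boot all_order all_algebra finmap.
From mathcomp Require Import all_classical all_reals all_analysis.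

Set Implicit Arguments.
Unset Strict Implicit.
Unset Printing Implicit Defensive.

Import Order.TTheory GRing.Theory Num.Theory.
Import numFieldNormedType.Exports.

Local Open Scope classical_set_scope.
Local Open Scope ring_scope.
Local Open Scope ereal_scope.

#[short(type="completeMetricType")]
HB.structure Definition CompleteMetric (R : numDomainType) :=
  {T of Metric R T & CompletePseudoMetric R T}.

Definition separable_space (T : topologicalType) : Prop :=
  exists2 D : set T, countable D & dense D.

(* The carrier T equipped with its Borel sigma-algebra <<s open >>. For
   separable metric spaces the product sigma-algebra on borel S * borel T is
   the Borel sigma-algebra of the product space. *)
Notation borel T := (g_sigma_algebraType (@open T)).

Section independence.
Context d (Omega : measurableType d) (R : realType) (P : probability Omega R).

Definition identically_distributed d' (T : measurableType d') (I : set nat)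
    (Z : nat -> {RV P >-> T}) : Prop :=
  forall i j, I i -> I j -> forall A, measurable A ->
    distribution P (Z i) A = distribution P (Z j) A.

Definition mutually_independent d' (T : measurableType d') (I : set nat)
    (Z : nat -> {RV P >-> T}) : Prop :=
  forall (J : {fset nat}) (A : nat -> set T),
    [set` J] `<=` I -> (forall i, i \in J -> measurable (A i)) ->
    P (\bigcap_(i in [set` J]) (Z i @^-1` A i)) =
    \big[mule/1]_(i <- J) P (Z i @^-1` A i).

Definition iid d' (T : measurableType d') (I : set nat)
    (Z : nat -> {RV P >-> T}) : Prop :=
  mutually_independent I Z /\ identically_distributed I Z.

(* The sigma-algebra sigma(Z_i, i in I) on Omega. *)
Definition sigma_family d' (T : measurableType d') (I : set nat)
    (Z : nat -> {RV P >-> T}) : set (set Omega) :=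
  <<s \bigcup_(i in I) preimage_set_system setT (Z i) measurable >>.

Definition independent_of_family d1 d2 (S : measurableType d1)
    (T : measurableType d2) (U : {RV P >-> S}) (I : set nat)
    (Z : nat -> {RV P >-> T}) : Prop :=
  forall A B, measurable A -> sigma_family I Z B ->
    P ((U @^-1` A) `&` B) = P (U @^-1` A) * P B.

End independence.

Section wasserstein.
Context (R : realType) (T : completeMetricType R).

Definition couplings (nu1 nu2 : {measure set (borel T) -> \bar R}) :
    set (probability (borel T * borel T)%type R) :=
  [set lambda : probability (borel T * borel T)%type R |
    forall A : set (borel T), measurable A ->
      lambda (fst @^-1` A) = nu1 A /\ lambda (snd @^-1` A) = nu2 A].

(* Meant for probability measures: for other arguments there is no coupling
   and the infimum is +oo. *)
Definition W1 (nu1 nu2 : {measure set (borel T) -> \bar R}) : \bar R :=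
  ereal_inf [set \int[lambda]_z (mdist (z.1 : T) (z.2 : T))%:E
            | lambda in couplings nu1 nu2].

(* Averages the Dirac masses at x 1, ..., x n (x 0 is not used). *)
Definition empirical_measure (n : nat) (x : nat -> borel T) :
    {measure set (borel T) -> \bar R} :=
  mscale ((n%:R^-1)%:nng)%R (msum (fun k => dirac (x k.+1)) n).

Lemma empirical_measure_setT (n : nat) (x : nat -> borel T) :
  (0 < n)%N -> empirical_measure n x setT = 1.
Proof.
move=> n0; rewrite /empirical_measure /= /mscale /= /msum.
rewrite (eq_bigr (fun=> 1%:E)) => [|k _]; last exact: diracT.
rewrite sumEFin big_const_ord iter_addr addr0 -EFinM mulVf //.
by rewrite pnatr_eq0 -lt0n.
Qed.

End wasserstein.

Section chain.
Context (R : realType) (X Y : completeMetricType R).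
Context d (Omega : measurableType d) (P : probability Omega R).

(* P_e is the law of the innovations: the transition kernel of the chain is
   Q(x, A) = P_e {y | F (x, y) in A}. *)
Definition invariant_distribution (F : borel X * borel Y -> borel X)
    (P_e : probability (borel Y) R) (mu : probability (borel X) R) : Prop :=
  forall A : set (borel X), measurable A ->
    \int[mu]_x P_e [set y | A (F (x, y))] = mu A.

Definition G_X1 (X1 : {RV P >-> borel X}) (x : X) : \bar R :=
  \int[distribution P X1]_x' (mdist x (x' : X))%:E.

Definition G_eps (C : R) (e : {RV P >-> borel Y}) (y : Y) : \bar R :=
  \int[distribution P e]_y' (C * mdist y (y' : Y))%:E.

(* The chain is indexed from 1: X_ 0 and eps 0 are not constrained. *)
Definition is_chain (F : borel X * borel Y -> borel X)
    (eps : nat -> {RV P >-> borel Y}) (X_ : nat -> {RV P >-> borel X}) : Prop :=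
  forall n, (2 <= n)%N -> forall w, X_ n w = F (X_ n.-1 w, eps n w).

(* Kept in \bar R so that the deviation below is finite only if W1 and its
   expectation are. *)
Definition mean_W1 (X_ : nat -> {RV P >-> borel X})
    (mu : probability (borel X) R) (n : nat) : \bar R :=
  \int[P]_w W1 (empirical_measure n (fun k => X_ k w)) mu.

Definition W1_deviation (X_ : nat -> {RV P >-> borel X})
    (mu : probability (borel X) R) (n : nat) (w : Omega) : \bar R :=
  `| W1 (empirical_measure n (fun k => X_ k w)) mu - mean_W1 X_ mu n |.

End chain.

(* Main.v *)
Require Import Defs.
From HB Require Import structures.
From mathcomp Require Import all_boot all_order all_algebra finmap.
From mathcomp Require Import all_classical all_reals all_analysis.
From mathcomp Require Import measurable_realfun zify ring lra.

Set Implicit Arguments.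
Unset Strict Implicit.
Unset Printing Implicit Defensive.

Import Order.TTheory GRing.Theory Num.Theory.
Import numFieldNormedType.Exports.

Local Open Scope classical_set_scope.
Local Open Scope ring_scope.
Local Open Scope ereal_scope.

(** Let f (x_1, ..., x_n) be n times the Wasserstein distance between the
    empirical measure of x_1, ..., x_n and mu. The theorem is a deviation
    inequality for f (X_1, ..., X_n) around its mean, and the only property
    of f that matters is that moving x_i to x'_i changes f by at most
    d (x_i, x'_i) ([W1_lipschitz], where an explicit coupling is built; the
    values of f are finite because [invariant_first_moment] gives mu a first
    moment).

    Put L = 1 / (1 - rho). Integrating the innovation eps_k out of a function
    of the path that is 1-Lipschitz in x_1, ..., x_(k-1) and L-Lipschitz in
    x_k gives a function of the same kind with k - 1 in place of k, since
    1 + rho L = L ([average_lipschitz]). The differences between f and its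
    successive averages are martingale increments. The k-th one is, given the
    past, a centred function of eps_k whose oscillation between y and y' is
    at most L C delta (y, y'); it is therefore bounded by L G_eps (eps_k),
    and its conditional Laplace transform at t is at most exp (c t^2) for
    small t ([oscillation_bounds], [oscillation_mgf]). The first increment is
    bounded by L G_X1 (X_1). Multiplying the conditional bounds along the
    chain ([chain_concentration]) yields exp (c n t^2) for the Laplace
    transform of the centred f.

    Chernoff's bound then gives the Gaussian regime on any bounded range of x
    ([chernoff]). For large x no martingale is needed: if the deviation
    exceeds n x then so does the sum of the bounds H_k of the increments, so
    by convexity the sum of the H_k^p is at least n x^p, and H_1, ..., H_n are
    independent with exponential moments of order p ([power_regime],
    [exp_sum_moment]).

    Conditional expectations never appear. The past is the type [history] of
    outcomes with the sigma-algebra generated by X_1, eps_2, ..., eps_k, and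
    [freezing] integrates the next innovation out of a jointly measurable
    function. Measurability of all the path functionals comes from
    [lipschitz_measurable]. *)

(** * Measurability of Lipschitz functionals *)

Section lipschitz_measurability.
Context (R : realType) (T : completeMetricType R) (sepT : separable_space T).

Lemma dense_sequence : exists q : nat -> T,
  forall (x : T) (e : R), (0 < e)%R -> exists j, (mdist x (q j) < e)%R.
Proof.
case: sepT => D cD dD.
have near (x : T) (e : R) : (0 < e)%R -> exists2 y, D y & (mdist x y < e)%R.
  move=> e0.
  have [|y [By Dy]] := dD (ball x e)°%classic _ (@open_interior _ _).
    exists x; exact: nbhsx_ballx.
  exists y => //; have := interior_subset By.
  by rewrite ballEmdist.
have [z0 Dz0 _] := near point 1%R ltr01.
have /pfcard_geP[D0|[q]] : ([set: nat] #>= D)%card by [].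
  by move: Dz0; rewrite D0.
exists q => x e e0; have [y Dy xy] := near x e e0.
have [j _ qj] := @surj _ _ _ _ q y Dy.
by exists j; rewrite qj.
Qed.

Lemma measurable_fun_lt d (E : measurableType d) (f : E -> R) :
  (forall c, measurable [set t | (f t < c)%R]) -> measurable_fun [set: E] f.
Proof.
move=> mf mD; apply: (measurability _ (measurable_realfun.RGenInftyO.measurableE R)) => //.
move=> _ [_ [x ->] <-]; rewrite setTI.
rewrite [X in measurable X](_ : _ = [set t | (f t < x)%R]); first exact: mf.
by apply/seteqP; split => t /=; rewrite in_itv.
Qed.

Lemma measurable_mdistl d (E : measurableType d) (h : E -> borel T) (y : T) :
  measurable_fun [set: E] h ->
  measurable_fun [set: E] (fun t => mdist (h t : T) y).
Proof.
move=> mh; apply: measurable_fun_lt => c.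
rewrite -[X in measurable X]setTI.
rewrite [X in measurable X](_ : _ = [set: E] `&` h @^-1` (fun x => (mdist x y < c)%R))//.
apply: mh => //; apply: sub_sigma_algebra; rewrite openE => x /= xc.
apply/nbhs_ballP; exists (c - mdist x y)%R; rewrite /= ?subr_gt0// => z.
rewrite ballEmdist /= => xz; have := metric_triangle z x y; rewrite (metric_sym z x); lra.
Qed.

(** A Lipschitz function is the infimum of countably many cones whose
    vertices have coordinates in a dense sequence, and each cone depends on
    the arguments through distances to fixed points only. Separability is
    what makes the distance between two random points measurable. *)
Lemma lipschitz_measurable d (E : measurableType d) (n : nat)
    (h : nat -> E -> borel T) (L : R) (g : (nat -> T) -> R) :
  (forall i, (i < n)%N -> measurable_fun [set: E] (h i.+1)) ->
  (forall x x' : nat -> T,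
    (`|g x - g x'| <= L * \sum_(i < n) mdist (x i.+1) (x' i.+1))%R) ->
  measurable_fun [set: E] (fun t => g (fun i => h i t)).
Proof.
move=> mh gL.
have [q qd] := dense_sequence.
(* the vertices, enumerated by codes of finite sequences of integers *)
pose s (m i : nat) : T := q (nth 0%N (CodeSeq.decode m) i).
(* a positive constant, since L itself may be nonpositive *)
pose L' := (`|L| + 1)%R; have L'0 : (0 < L')%R by rewrite ltr_wpDl.
have gL' x x' : (`|g x - g x'| <= L' * \sum_(i < n) mdist (x i.+1) (x' i.+1))%R.
  apply: le_trans (gL x x') _; rewrite ler_wpM2r ?sumr_ge0// => [i _|].
    exact: mdist_ge0.
  by rewrite (le_trans (ler_norm L))// lerDl.
apply: measurable_fun_lt => c.
rewrite [X in measurable X](_ : _ = \bigcup_m [set t |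
    (g (s m) + L' * \sum_(i < n) mdist (h i.+1 t : T) (s m i.+1) < c)%R]); last first.
  apply/seteqP; split => t /=.
    move=> tc; pose e := ((c - g (fun i => h i t)) / (2 * L' * n.+1%:R))%R.
    have e0 : (0 < e)%R by rewrite divr_gt0 ?subr_gt0// !mulr_gt0.
    have /choice[j jP] : forall i, exists j, (mdist (h i t : T) (q j) < e)%R.
      by move=> i; exact: qd.
    exists (CodeSeq.code (mkseq j n.+1)); first by [].
    set x' := s _; change (g x' + L' * \sum_(i < n) mdist (h i.+1 t : T) (x' i.+1) < c)%R.
    have x'E (i : 'I_n) : x' i.+1 = q (j i.+1).
      by rewrite /x' /s CodeSeq.codeK nth_mkseq// ltnS.
    have sume : (\sum_(i < n) mdist (h i.+1 t : T) (x' i.+1) <= n%:R * e)%R.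
      rewrite -[n in leRHS]card_ord -sumr_const mulr_suml ler_sum// => i _.
      by rewrite mul1r x'E ltW.
    have := gL' (fun i => h i t) x'; rewrite ler_norml => /andP[+ _].
    have : (L' * (\sum_(i < n) mdist (h i.+1 t : T) (x' i.+1)) <= L' * (n%:R * e))%R.
      by rewrite ler_pM2l.
    have : (2 * (L' * (n%:R * e)) < c - g (fun i => h i t))%R.
      rewrite [ltLHS](_ : _ = (n%:R / n.+1%:R) * (c - g (fun i => h i t)))%R; last first.
        by rewrite /e; field; rewrite addrC natr1 pnatr_eq0 (gt_eqF L'0).
      by rewrite gtr_pMl ?subr_gt0// ltr_pdivrMr// mul1r ltr_nat.
    lra.
  move=> [m _ /=]; apply: le_lt_trans.
  by have := gL' (fun i => h i t) (s m); rewrite ler_norml => /andP[_]; lra.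
apply: bigcupT_measurable => m.
rewrite -[X in measurable X]setTI -[X in _ `&` X]preimage_true.
apply: measurable_fun_ltr => //.
apply: measurable_funD => //; apply: measurable_funM => //.
apply: measurable_sum => i; apply: measurable_mdistl; exact: mh.
Qed.

Lemma measurable_mdist d (E : measurableType d) (h1 h2 : E -> borel T) :
  measurable_fun [set: E] h1 -> measurable_fun [set: E] h2 ->
  measurable_fun [set: E] (fun t => mdist (h1 t : T) (h2 t : T)).
Proof.
move=> mh1 mh2.
pose h (i : nat) := if i == 1%N then h1 else h2.
apply: (@lipschitz_measurable _ E 2 h 1%R (fun x => mdist (x 1%N) (x 2%N))).
  by rewrite /h => -[|[|]].
move=> x x'; rewrite big_ord_recl big_ord1 mul1r /=.
have t1 := metric_triangle (x 1%N) (x' 1%N) (x 2%N).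
have t2 := metric_triangle (x' 1%N) (x' 2%N) (x 2%N).
have t3 := metric_triangle (x' 1%N) (x 1%N) (x' 2%N).
have t4 := metric_triangle (x 1%N) (x 2%N) (x' 2%N).
have := metric_sym (x 1%N) (x' 1%N); have := metric_sym (x 2%N) (x' 2%N).
rewrite ler_norml /bump /=; move=> *; lra.
Qed.

End lipschitz_measurability.

(** * Restricting, pushing and normalizing measures *)

Section restricted_integral.
Context d (T : measurableType d) (R : realType).

(** The measure is the sum of its restrictions to D and to its complement,
    and each of them neglects the other set. *)
Lemma ge0_integral_mrestr (mu : {measure set T -> \bar R}) (D : set T)
    (mD : measurable D) (f : T -> \bar R) :
  measurable_fun [set: T] f -> (forall x, 0 <= f x) ->
  \int[mrestr mu mD]_x f x = \int[mu]_(x in D) f x.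
Proof.
move=> mf f0; have mCD : measurable (~` D) by exact: measurableC.
have splitmu A : measurable A -> A `<=` setT ->
    mu A = measure_add (mrestr mu mD) (mrestr mu mCD) A.
  move=> mA _; rewrite measure_addE /= /mrestr -measureU.
  - by rewrite -setIUr setUv setIT.
  - exact: measurableI.
  - exact: measurableI.
  - by rewrite setIACA setICr setI0.
rewrite [RHS]integral_mkcond.
rewrite (eq_measure_integral _ splitmu) ge0_integral_measure_add//; last 2 first.
  by move=> x _; exact: erestrict_ge0.
  by apply/(measurable_restrictT _ mD).1; exact: measurable_funTS.
rewrite [X in _ = _ + X](_ : _ = 0); last first.
  rewrite -integral_mkcond; apply: null_set_integral => //.
    exact: measurable_funTS.
  by rewrite /= /mrestr setICr measure0.
rewrite adde0 -integral_mkcond.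
rewrite (@ge0_negligible_integral _ _ _ _ setT (~` D))//.
  by rewrite setTD setCK.
by rewrite /= /mrestr setICl measure0.
Qed.

(** The building block of couplings: it carries, along h, the part of mu
    that lives on D. *)
Lemma scaled_pushforward_restriction d' (T' : measurableType d')
    (mu : {measure set T -> \bar R}) (D : set T) (c : R) (h : T -> T') :
  measurable D -> (0 <= c)%R -> measurable_fun [set: T] h ->
  exists nu : {measure set T' -> \bar R},
    (forall A, nu A = c%:E * mu (h @^-1` A `&` D)) /\
    (forall f : T' -> \bar R, measurable_fun [set: T'] f -> (forall y, 0 <= f y) ->
      \int[nu]_y f y = c%:E * \int[mu]_(x in D) f (h x)).
Proof.
move=> mD c0 mh.
pose push := measure_function_pushforward__canonical__measure_function_Measure
  (mrestr mu mD) mh.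
exists (mscale (NngNum c0) push); split => // f mf f0.
rewrite ge0_integral_mscale//; congr (_ * _).
rewrite ge0_integral_pushforward// preimage_setT ge0_integral_mrestr//.
  exact: measurableT_comp.
by move=> x; exact: f0.
Qed.

End restricted_integral.

Lemma probability_of_measure d (T : measurableType d) (R : realType)
    (m : {measure set T -> \bar R}) :
  m setT = 1 -> exists Q : probability T R, forall A, Q A = m A.
Proof.
move=> m1.
exists (mnormalize m (dirac point)).
move=> A /=; by rewrite /mnormalize m1 /= gt_eqF//= invr1 mule1.
Qed.

(** * Distance from an empirical measure *)

Section wasserstein_empirical.
Context (R : realType) (T : completeMetricType R) (sepT : separable_space T).
Context (mu : probability (borel T) R).
Implicit Types (n : nat) (x : nat -> borel T).

Local Notation cost := (fun z : borel T * borel T => (mdist (z.1 : T) (z.2 : T))%:E).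

Lemma measurable_cost : measurable_fun [set: borel T * borel T] cost.
Proof. by apply/measurable_EFinP; exact: measurable_mdist. Qed.

Lemma cost_ge0 z : 0 <= cost z. Proof. by rewrite lee_fin mdist_ge0. Qed.

Lemma measurable_mdist_l (y : T) : measurable_fun [set: borel T]
  (fun z : borel T => (mdist y (z : T))%:E).
Proof. by apply/measurable_EFinP; exact: measurable_mdist. Qed.

Lemma empirical_measureE n x (A : set (borel T)) :
  empirical_measure n x A = (n%:R^-1 * \sum_(k < n) \1_A (x k.+1))%:E.
Proof.
rewrite /empirical_measure /= /mscale /= /msum EFinM; congr (_ * _).
by rewrite -sumEFin; apply: eq_bigr => k _.
Qed.

Lemma W1_ge0 (nu : {measure set (borel T) -> \bar R}) : 0 <= W1 nu mu.
Proof.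
apply: le_ereal_inf_tmp => _ [lam _ <-].
by apply: integral_ge0 => z _; exact: cost_ge0.
Qed.

Lemma measurable_set1 (a : T) : measurable ([set a] : set (borel T)).
Proof.
rewrite [X in measurable X](_ : _ = ~` [set z | (0 < mdist (z : T) a)%R]); last first.
  apply/seteqP; split => z /=; first by move=> ->; rewrite mdistxx ltxx.
  by move/negP; rewrite mdist_gt0 negbK => /eqP.
apply: measurableC; rewrite -[X in measurable X]setTI -[X in _ `&` X]preimage_true.
by apply: measurable_fun_ltr => //; exact: measurable_mdist.
Qed.

(** The product coupling has finite cost. *)
Lemma W1_finite n x (y : T) : (0 < n)%N ->
  \int[mu]_z (mdist y (z : T))%:E < +oo -> W1 (empirical_measure n x) mu \is a fin_num.
Proof.
move=> n0 muy; rewrite ge0_fin_numE ?W1_ge0//.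
have [nu nuE] := probability_of_measure (empirical_measure_setT x n0).
have pi1 : product_measure1 nu mu setT = 1.
  rewrite -setXTT [LHS]product_measure1E// -[RHS]mule1.
  congr (_ * _); exact: probability_setT.
have [lam lamE] := probability_of_measure pi1.
have lamC : couplings (empirical_measure n x) mu lam.
  move=> A mA; rewrite !lamE.
  rewrite (_ : fst @^-1` A = A `*` setT); last by apply/seteqP; split => z //= -[].
  rewrite (_ : snd @^-1` A = setT `*` A); last by apply/seteqP; split => z //= -[].
  split; rewrite [LHS]product_measure1E//.
    by rewrite -nuE -[RHS]mule1; congr (_ * _); exact: probability_setT.
  by rewrite -[RHS]mul1e; congr (_ * _); exact: probability_setT.
apply: le_lt_trans (ereal_inf_lbound _) _; first by exists lam.
rewrite (@eq_measure_integral _ _ _ _ (product_measure1 nu mu)); last by move=> A _ _; exact: lamE.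
rewrite fubini_tonelli1; [|exact: measurable_cost|exact: cost_ge0].
rewrite (@eq_measure_integral _ _ _ _ (empirical_measure n x)); last by move=> A _ _; exact: nuE.
have mF : measurable_fun setT (fubini_F mu cost).
  apply: measurable_fun_fubini_tonelli_F; [exact: measurable_cost|exact: cost_ge0].
have F0 u : 0 <= fubini_F mu cost u by apply: integral_ge0 => z _; exact: cost_ge0.
rewrite ge0_integral_mscale//.
rewrite ge0_integral_measure_sum//.
rewrite lte_mul_pinfty// ?lee_fin// lte_sum_pinfty// => k _.
rewrite integral_dirac// diracT mul1e /fubini_F /=.
apply: (@le_lt_trans _ _ (\int[mu]_z ((mdist (x k.+1 : T) y)%:E + (mdist y (z : T))%:E))).
  apply: ge0_le_integral => //.
  - by move=> z _; rewrite lee_fin mdist_ge0.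
  - exact: measurable_mdist_l.
  - by apply: emeasurable_funD => //; exact: measurable_mdist_l.
  - by move=> z _; rewrite -EFinD lee_fin; exact: metric_triangle.
rewrite ge0_integralD//; last 3 first.
  by move=> z _; rewrite lee_fin mdist_ge0.
  by move=> z _; rewrite lee_fin mdist_ge0.
  exact: measurable_mdist_l.
by rewrite integral_cst//= probability_setT mule1 lte_add_pinfty// ltry.
Qed.

(** The sample points need not be distinct, so the mass that a coupling puts
    on an atom is shared equally between the indices of that atom. *)
Section transport.
Context (n : nat) (x : nat -> borel T).

Definition multiplicity (k : nat) : R := \sum_(j < n) \1_[set x k.+1] (x j.+1).

Lemma multiplicity_gt0 (k : nat) : (k < n)%N -> (0 < multiplicity k)%R.
Proof.
move=> kn; rewrite /multiplicity (bigD1 (Ordinal kn))//= indicE mem_set//.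
by rewrite ltr_wpDr// sumr_ge0// => j _; rewrite indicE.
Qed.

Lemma sum_multiplicity (z : borel T) :
  (\sum_(k < n) (multiplicity k)^-1 * \1_[set x k.+1] z = \1_[set x k.+1 | k in `I_n] z)%R.
Proof.
rewrite [RHS]indicE; case: (boolP (z \in _)) => zI /=; last first.
  apply: big1 => k _; rewrite indicE; case: (boolP (z \in _)) => [|_]; last by rewrite mulr0.
  rewrite inE /= => zk; case/negP: zI; rewrite inE; exists k => //=.
have [j jn xjz] : [set x k.+1 | k in `I_n] z by rewrite -inE.
rewrite (eq_bigr (fun k : 'I_n => (multiplicity j)^-1 * \1_[set x j.+1] (x k.+1)))%R.
  by rewrite -mulr_sumr -/(multiplicity j) mulVf// gt_eqF// multiplicity_gt0.
move=> k _; rewrite !indicE !in_set1 -xjz (eq_sym (x k.+1)).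
case: eqP => [jk|]; last by rewrite !mulr0.
by rewrite /multiplicity jk.
Qed.

Context (lam : probability (borel T * borel T)%type R).
Context (lamC : couplings (empirical_measure n x) mu lam).

(** The first marginal of lam lives on the atoms, so the weights cut lam in n
    pieces, the k-th of which has first marginal concentrated at x k.+1. *)
Lemma sum_restricted (f : borel T * borel T -> R) :
  measurable_fun setT f -> (forall z, 0 <= f z)%R ->
  \sum_(k < n) (multiplicity k)^-1%:E *
     \int[lam]_(z in fst @^-1` [set x k.+1]) (f z)%:E = \int[lam]_z (f z)%:E.
Proof.
move=> mf f0.
have mf' : measurable_fun setT (EFin \o f) by exact/measurable_EFinP.
have mA k : measurable (fst @^-1` [set x k.+1] : set (borel T * borel T)).
  by rewrite -[X in measurable X]setTI; apply: measurable_fst => //; exact: measurable_set1.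
have mfA k : measurable_fun setT ((fun z => (f z)%:E) \_ (fst @^-1` [set x k.+1])).
  have mf'k : measurable_fun (fst @^-1` [set x k.+1]) (EFin \o f) by exact: measurable_funTS mf'.
  exact: (measurable_restrictT _ (mA k)).1 mf'k.
pose supp : set (borel T) := [set x k.+1 | k in `I_n].
have msupp : measurable supp.
  rewrite (_ : supp = \bigcup_(k in `I_n) [set x k.+1]).
    by apply: bigcup_measurable => k _; exact: measurable_set1.
  by apply/seteqP; split => z [k kn xz]; exists k.
have mS : measurable (fst @^-1` supp : set (borel T * borel T)).
  by rewrite -[X in measurable X]setTI; apply: measurable_fst.
have null : lam (~` (fst @^-1` supp)) = 0.
  rewrite preimage_setC (lamC (measurableC msupp)).1 empirical_measureE big1 ?mulr0// => k _.
  by rewrite indicE memNset//= => /(_ _); apply; exists (val k) => //=.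
rewrite [RHS](@ge0_negligible_integral _ _ _ _ setT (~` (fst @^-1` supp)))//; last 2 first.
  exact: measurableC.
  by move=> z _; rewrite lee_fin.
rewrite setTD setCK [RHS]integral_mkcond.
transitivity (\sum_(k < n) \int[lam]_z ((multiplicity k)^-1%:E *
    ((fun z => (f z)%:E) \_ (fst @^-1` [set x k.+1])) z)).
  apply: eq_bigr => k _; rewrite ge0_integralZl//; first by rewrite -integral_mkcond.
    by move=> z _; apply: erestrict_ge0 => w _; rewrite lee_fin.
  by rewrite lee_fin invr_ge0 ltW// multiplicity_gt0.
rewrite -ge0_integral_sum//; last 2 first.
  by move=> k; apply: measurable_funeM; exact: mfA.
  move=> k z _; rewrite mule_ge0//.
    by rewrite lee_fin invr_ge0 sumr_ge0// => j _; rewrite indicE.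
  by apply: erestrict_ge0 => w _; rewrite lee_fin.
have mem_fst (S : set (borel T)) z : (z \in fst @^-1` S) = (z.1 \in S) :> bool.
  by apply/idP/idP; rewrite !inE.
apply: eq_integral => z _.
transitivity ((\sum_(k < n) (multiplicity k)^-1 * \1_[set x k.+1] z.1) * f z)%:E.
  rewrite mulr_suml -sumEFin; apply: eq_bigr => k _.
  rewrite patchE indicE -mulrA EFinM mem_fst.
  by case: ifP => _; rewrite ?mul1r ?mul0r.
rewrite sum_multiplicity patchE indicE mem_fst.
by case: ifP => _; rewrite ?mul1r ?mul0r.
Qed.

(** In the k-th piece of lam the first coordinate is moved from x k.+1 to
    y k.+1. Each piece has mass 1 / n, so by the triangle inequality this
    costs at most the average displacement. *)
Lemma transport_coupling (y : nat -> borel T) : (0 < n)%N ->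
  exists2 lam' : probability (borel T * borel T)%type R,
    couplings (empirical_measure n y) mu lam' &
    \int[lam']_z cost z <= \int[lam]_z cost z +
      (n%:R^-1 * \sum_(k < n) mdist (y k.+1 : T) (x k.+1))%:E.
Proof.
move=> n0.
have m0 k : (0 <= (multiplicity k)^-1)%R.
  by rewrite invr_ge0 sumr_ge0// => j _; rewrite indicE.
pose atom k : set (borel T * borel T) := fst @^-1` [set x k.+1].
have matom k : measurable (atom k).
  by rewrite -[X in measurable X]setTI; apply: measurable_fst => //; exact: measurable_set1.
pose h k (z : borel T * borel T) := (y k.+1, z.2).
have mh k : measurable_fun setT (h k) by exact: measurable_fun_pair.
have /choice[nu nuP] k :=
  @scaled_pushforward_restriction _ _ R _ _ lam _ _ _ (matom k) (m0 k) (mh k).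
have nuE k A := (nuP k).1 A; have nuI k := (nuP k).2.
have atomE k : (k < n)%N -> ((multiplicity k)^-1%:E * lam (atom k) = n%:R^-1%:E).
  move=> kn; rewrite /atom (lamC (measurable_set1 _)).1 empirical_measureE -EFinM.
  by rewrite mulrCA mulVf ?mulr1// gt_eqF// multiplicity_gt0.
have sndE A : measurable A -> msum nu n (snd @^-1` A) = mu A.
  move=> mA; rewrite /= /msum -(lamC mA).2.
  have mA' : measurable (snd @^-1` A : set (borel T * borel T)).
    by rewrite -[X in measurable X]setTI; exact: measurable_snd.
  have := @sum_restricted (\1_(snd @^-1` A)).
  rewrite integral_indic// setIT => <-//.
  by apply: eq_bigr => k _; rewrite nuE integral_indic//; exact: matom.
have nuT : msum nu n setT = 1 by rewrite -(preimage_setT snd) sndE// probability_setT.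
have [lam' lam'E] := probability_of_measure nuT.
exists lam'.
  move=> A mA; rewrite !lam'E; split; last exact: sndE.
  rewrite /= /msum empirical_measureE mulr_sumr -sumEFin; apply: eq_bigr => k _.
  rewrite nuE EFinM -(atomE k (ltn_ord k)) indicE.
  have [yA|nyA] := pselect (A (y k.+1)).
    rewrite mem_set// mule1; congr (_ * lam _); apply/seteqP.
    by split => z //=; case.
  rewrite memNset// mule0 (_ : _ `&` _ = set0) ?measure0 ?mule0//.
  by apply/seteqP; split => z // [].
rewrite (@eq_measure_integral _ _ _ _ (msum nu n)); last by move=> A _ _; exact: lam'E.
rewrite ge0_integral_measure_sum//; last 2 first.
- by move=> z _; exact: cost_ge0.
- exact: measurable_cost.
rewrite (eq_bigr (fun k : 'I_n => (multiplicity k)^-1%:E * \int[lam]_(z in atom k)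
    (mdist (y k.+1 : T) (z.2 : T))%:E)); last first.
  by move=> k _; rewrite nuI//; [exact: measurable_cost|move=> z; exact: cost_ge0].
rewrite -(@sum_restricted (fun z => mdist (z.1 : T) (z.2 : T))); last 2 first.
  exact: measurable_mdist.
  by move=> z; exact: mdist_ge0.
rewrite mulr_sumr -sumEFin -big_split /=; apply: lee_sum => k _.
rewrite EFinM -(atomE k (ltn_ord k)) -muleA -ge0_muleDr//; last 2 first.
- by apply: integral_ge0 => z _; exact: cost_ge0.
- by rewrite mule_ge0// lee_fin mdist_ge0.
rewrite lee_pmul2l//; last by rewrite lte_fin invr_gt0 multiplicity_gt0.
rewrite [lam _ * _]muleC -integral_cst; last exact: matom.
rewrite -ge0_integralD//; last 4 first.
- exact: matom.
- by move=> z _; exact: cost_ge0.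
- exact: measurable_funTS measurable_cost.
- by move=> z _; rewrite lee_fin mdist_ge0.
apply: ge0_le_integral => //.
- by move=> z _; rewrite lee_fin mdist_ge0.
- apply/measurable_EFinP/measurable_funTS; exact: measurable_mdist.
- apply: emeasurable_funD => //; exact: measurable_funTS measurable_cost.
- move=> z zx; rewrite -EFinD lee_fin addrC zx; exact: metric_triangle.
Qed.

End transport.

Lemma W1_lipschitz n (x y : nat -> borel T) : (0 < n)%N ->
  W1 (empirical_measure n y) mu <= W1 (empirical_measure n x) mu +
    (n%:R^-1 * \sum_(k < n) mdist (y k.+1 : T) (x k.+1))%:E.
Proof.
move=> n0; rewrite -leeBlDr//; apply: le_ereal_inf_tmp => _ [lam lamC <-].
have [lam' lam'C lam'le] := transport_coupling lamC y n0.
rewrite leeBlDr//; apply: le_trans lam'le.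
by apply: ereal_inf_lbound; exists lam'.
Qed.

End wasserstein_empirical.

(** * First moment of the invariant distribution *)

Section invariant_moment.
Context (R : realType) (X Y : completeMetricType R) (sepX : separable_space X).
Context (F : borel X * borel Y -> borel X)
  (F_meas : measurable_fun [set: borel X * borel Y] F).
Context (P_e : probability (borel Y) R) (mu : probability (borel X) R).
Context (mu_inv : invariant_distribution F P_e mu).

(** Invariance says that mu is the image of its product with P_e under F. *)
Lemma invariant_integral (f : borel X -> \bar R) :
  measurable_fun setT f -> (forall x, 0 <= f x) ->
  \int[mu]_x \int[P_e]_y f (F (x, y)) = \int[mu]_x f x.
Proof.
move=> mf f0.
have muE A : measurable A -> A `<=` setT -> mu A = pushforward (product_measure1 mu P_e) F A.
  move=> mA _; rewrite -(mu_inv mA) /pushforward /product_measure1.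
  apply: eq_integral => x _ /=; congr (P_e _).
  by apply/seteqP; split => y; rewrite /xsection /= inE.
rewrite [RHS](eq_measure_integral _ muE) ge0_integral_pushforward// preimage_setT.
rewrite fubini_tonelli1//; first by exact: measurableT_comp.
by move=> z; exact: f0.
Qed.

Context (rho : R) (rho_ge0 : (0 <= rho)%R) (rho_lt1 : (rho < 1)%R).
Context (contract : forall x x' : X,
  \int[P_e]_y (mdist (F (x, y) : X) (F (x', y) : X))%:E <= (rho * mdist x x')%:E).

(** Drift argument: V (z) = d (x0, z) satisfies QV <= rho V + b for the
    transition kernel Q, which would give (1 - rho) mu V <= b if mu V were
    known to be finite. As it is not, V is truncated at a level M, and
    (1 - rho) V is integrated on the set where V <= M before M tends to
    infinity. *)
Lemma invariant_first_moment (x0 : X) :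
  \int[P_e]_y (mdist x0 (F (x0, y) : X))%:E < +oo ->
  \int[mu]_z (mdist x0 (z : X))%:E < +oo.
Proof.
move=> bfin.
pose V (z : borel X) := mdist x0 (z : X).
have V0 z : (0 <= V z)%R by exact: mdist_ge0.
have mV : measurable_fun setT V by exact: measurable_mdist.
have mFx x : measurable_fun setT (fun y : borel Y => F (x, y)).
  by apply: measurableT_comp => //; exact: measurable_fun_pair.
pose b := fine (\int[P_e]_y (V (F (x0, y)))%:E).
have bE : \int[P_e]_y (V (F (x0, y)))%:E = b%:E.
  by rewrite fineK// ge0_fin_numE//; apply: integral_ge0 => y _; rewrite lee_fin.
have b0 : (0 <= b)%R.
  by rewrite -lee_fin -bE; apply: integral_ge0 => y _; rewrite lee_fin.
have drift x : \int[P_e]_y (V (F (x, y)))%:E <= (rho * V x + b)%:E.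
  rewrite EFinD -bE; apply: le_trans (leeD2r _ (contract x0 x)).
  have mVF z : measurable_fun setT (fun y => (V (F (z, y)))%:E).
    by apply/measurable_EFinP; exact: measurableT_comp.
  rewrite -ge0_integralD//; last 3 first.
  - by move=> y _; rewrite lee_fin mdist_ge0.
  - by apply/measurable_EFinP; exact: measurable_mdist.
  - by move=> y _; rewrite lee_fin.
  apply: ge0_le_integral => //.
  - by move=> y _; rewrite lee_fin.
  - by apply: emeasurable_funD => //; apply/measurable_EFinP; exact: measurable_mdist.
  - move=> y _; rewrite -EFinD lee_fin addrC; exact: metric_triangle.
pose VM (M : nat) z := Num.min (V z) M%:R.
pose WM (M : nat) z := Num.min (rho * V z + b)%R M%:R.
have rV0 z : (0 <= rho * V z + b)%R by rewrite addr_ge0// mulr_ge0.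
have VM0 M z : (0 <= VM M z)%R by rewrite le_min V0 ler0n.
have WM0 M z : (0 <= WM M z)%R by rewrite le_min rV0 ler0n.
have mVM M : measurable_fun setT (VM M) by apply: measurable_minr.
have mrV : measurable_fun setT (fun z => rho * V z + b)%R.
  by apply: measurable_funD => //; exact: measurable_funM.
have mWM M : measurable_fun setT (WM M) by exact: measurable_minr.
(* invariance for min V M, then Q (min V M) <= min (QV) M *)
have VMW M : \int[mu]_z (VM M z)%:E <= \int[mu]_z (WM M z)%:E.
  rewrite -invariant_integral; last 2 first.
  - exact/measurable_EFinP.
  - by move=> z; rewrite lee_fin.
  have mVMF x : measurable_fun setT (fun y => (VM M (F (x, y)))%:E).
    by apply/measurable_EFinP; exact: (measurableT_comp (mVM M)).
  apply: ge0_le_integral => //.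
  - by move=> x _; apply: integral_ge0 => y _; rewrite lee_fin.
  - have mVF : measurable_fun setT (fun z => (VM M (F z))%:E).
      by apply/measurable_EFinP; exact: (measurableT_comp (mVM M)).
    have VF0 z : 0 <= (VM M (F z))%:E by rewrite lee_fin.
    exact: (measurable_fun_fubini_tonelli_F (m2 := P_e) _ mVF VF0).
  - exact/measurable_EFinP.
  move=> x _; rewrite EFin_min le_min; apply/andP; split.
    apply: le_trans (drift x); apply: ge0_le_integral => //.
    - by move=> y _; rewrite lee_fin.
    - by apply/measurable_EFinP; exact: measurableT_comp.
    - by move=> y _; rewrite lee_fin ge_min lexx.
  rewrite -[leRHS]mule1 -(probability_setT P_e) -integral_cst//.
  apply: ge0_le_integral => //.
  - by move=> y _; rewrite lee_fin.
  - by move=> y _; rewrite lee_fin ge_min lexx orbT.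
pose g (M : nat) z := ((1 - rho) * (V z * \1_[set z | (V z <= M%:R)%R] z))%R.
have mset M : measurable [set z | (V z <= M%:R)%R].
  rewrite -[X in measurable X]setTI -[X in _ `&` X]preimage_true.
  exact: measurable_fun_ler.
have mg M : measurable_fun setT (fun z => (g M z)%:E).
  apply/measurable_EFinP; apply: measurable_funM => //; apply: measurable_funM => //.
have g0 M z : (0 <= g M z)%R.
  by rewrite !mulr_ge0 ?subr_ge0 ?(ltW rho_lt1)// indicE.
(* pointwise, g M + WM M <= VM M + b *)
have gle (M : nat) : \int[mu]_z (g M z)%:E <= b%:E.
  have WMfin : \int[mu]_z (WM M z)%:E \is a fin_num.
    rewrite ge0_fin_numE; last by apply: integral_ge0 => z _; rewrite lee_fin.
    apply: (@le_lt_trans _ _ (\int[mu]_z (M%:R)%:E)).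
      apply: ge0_le_integral => //.
      - by move=> z _; rewrite lee_fin.
      - exact/measurable_EFinP.
      - by move=> z _; rewrite lee_fin ge_min lexx orbT.
    by rewrite integral_cst//= probability_setT mule1 ltry.
  rewrite -(leeD2rE _ _ WMfin); apply: le_trans (leeD2l b%:E (VMW M)).
  rewrite -ge0_integralD//; last 3 first.
  - by move=> z _; rewrite lee_fin.
  - by move=> z _; rewrite lee_fin.
  - exact/measurable_EFinP.
  rewrite -[b%:E]mule1 -(probability_setT mu) -integral_cst// -ge0_integralD//; last 2 first.
  - by move=> z _; rewrite lee_fin.
  - exact/measurable_EFinP.
  apply: ge0_le_integral => //.
  - by move=> z _; rewrite -EFinD lee_fin addr_ge0.
  - by apply: emeasurable_funD => //; exact/measurable_EFinP.
  - by apply: emeasurable_funD => //; exact/measurable_EFinP.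
  move=> z _; rewrite -!EFinD lee_fin /g /WM /VM indicE.
  have ? : (0 <= (1 - rho) * V z)%R by rewrite mulr_ge0// subr_ge0 ltW.
  case: (leP (V z) M%:R) => VM'.
    rewrite mem_set//= mulr1; have : (Num.min (rho * V z + b) M%:R <= rho * V z + b)%R.
      by rewrite ge_min lexx.
    lra.
  rewrite memNset/=; last by apply/negP; rewrite -ltNge.
  rewrite !mulr0 add0r; have : (Num.min (rho * V z + b) M%:R <= M%:R)%R.
    by rewrite ge_min lexx orbT.
  lra.
have limg z : limn (fun M => (g M z)%:E) = ((1 - rho) * V z)%:E.
  apply/cvg_lim => //; apply: cvg_near_cst; near=> M.
  rewrite /g indicE mem_set ?mulr1//=.
  near: M; exact: nbhs_infty_ger.
have : \int[mu]_z ((1 - rho) * V z)%:E <= b%:E.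
  under eq_integral => z _ do rewrite -limg.
  rewrite monotone_convergence//; last 2 first.
  - by move=> M z _; rewrite lee_fin.
  - move=> z _ M N MN; rewrite lee_fin /g ler_wpM2l ?subr_ge0 ?(ltW rho_lt1)//.
    rewrite ler_wpM2l// !indicE ler_nat.
    case: (boolP (z \in _)) => //; rewrite inE /= => zM.
    by rewrite mem_set//= (le_trans zM)// ler_nat.
  apply: lime_le; last by apply: nearW.
  apply: ereal_nondecreasing_is_cvgn => M N MN.
  apply: ge0_le_integral => //.
  - by move=> z _; rewrite lee_fin.
  - move=> z _; rewrite lee_fin /g ler_wpM2l ?subr_ge0 ?(ltW rho_lt1)//.
    rewrite ler_wpM2l// !indicE ler_nat.
    case: (boolP (z \in _)) => //; rewrite inE /= => zM.
    by rewrite mem_set//= (le_trans zM)// ler_nat.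
under eq_integral => z _ do rewrite EFinM.
rewrite ge0_integralZl//; last 3 first.
- exact/measurable_EFinP.
- by move=> z _; rewrite lee_fin.
- by rewrite lee_fin subr_ge0 ltW.
have : (0 < (1 - rho)%:E) by rewrite lte_fin subr_gt0.
case: (\int[mu]_z _) => [r| |] // h; first by rewrite ltry.
by rewrite gt0_muley.
Unshelve. all: by end_near.
Qed.

End invariant_moment.

(** * Freezing the past *)

Section freezing.
Context d d1 d2 (Omega : measurableType d) (T : measurableType d1)
  (S : measurableType d2) (R : realType) (P : probability Omega R).

(** Independence identifies the joint law of U and V with a product measure,
    to which Tonelli's theorem applies. *)
Lemma freezing (U : Omega -> T) (V : {RV P >-> S}) (Q : probability S R)
    (f : T * S -> \bar R) : measurable_fun setT U ->
  (forall A B, measurable A -> measurable B ->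
    P (U @^-1` A `&` V @^-1` B) = P (U @^-1` A) * Q B) ->
  measurable_fun setT f -> (forall z, 0 <= f z) ->
  \int[P]_w f (U w, V w) = \int[P]_w \int[Q]_y f (U w, y).
Proof.
move=> mU indep mf f0.
pose U' : {RV P >-> T} := HB.pack U (isMeasurableFun.Build _ _ _ _ U mU).
have mUV : measurable_fun setT (fun w => (U w, V w)) by exact: measurable_fun_pair.
pose joint := measure_function_pushforward__canonical__measure_function_Measure P mUV.
have jointE A : measurable A -> A `<=` setT ->
    joint A = product_measure1 (distribution P U') Q A.
  move=> mA _; apply/esym.
  apply: (@product_measure_unique _ _ _ _ _ (distribution P U') Q joint) => //.
transitivity (\int[joint]_z f z).
  by rewrite ge0_integral_pushforward// preimage_setT.
rewrite (eq_measure_integral _ jointE) fubini_tonelli1//.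
rewrite ge0_integral_distribution//; first exact: measurable_fun_fubini_tonelli_F.
by move=> u; exact: integral_ge0.
Qed.

End freezing.

Section history.
Context d (Omega : measurableType d) (R : realType) (P : probability Omega R).
Context dX dY (X : measurableType dX) (Y : measurableType dY).
Context (X1 : {RV P >-> X}) (eps : nat -> {RV P >-> Y}).

(** The events that constrain X1 and the innovations of indices
    2, ..., m + 1 separately; they form a pi-system generating the
    sigma-algebra of the past at time m + 1. *)
Definition cylinder (m : nat) (A : set X) (B : nat -> set Y) : set Omega :=
  X1 @^-1` A `&` \bigcap_(i in `I_m) eps i.+2 @^-1` B i.+2.

Definition cylinders (m : nat) : set (set Omega) :=
  [set C | exists A B, [/\ measurable A, forall i, measurable (B i) &
    C = cylinder m A B]].

(** The outcomes seen through X1, eps 2, ..., eps m.+1 only: as a type it is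
    Omega, but with a coarser sigma-algebra. *)
Definition history (m : nat) := g_sigma_algebraType (cylinders m).

Lemma cylindersT m : cylinders m setT.
Proof.
exists setT, (fun=> setT); split => //.
by apply/esym; rewrite -subTset => w _; split => // i _.
Qed.

Lemma measurable_cylinder m A B : measurable A -> (forall i, measurable (B i)) ->
  measurable (cylinder m A B).
Proof.
move=> mA mB; apply: measurableI; first exact: measurable_funPTI.
by apply: fin_bigcap_measurable => // i _; exact: measurable_funPTI.
Qed.

Lemma cylinders_setI_closed m : setI_closed (cylinders m).
Proof.
move=> _ _ [A [B [mA mB ->]]] [A' [B' [mA' mB' ->]]].
exists (A `&` A'), (fun i => B i `&` B' i).
split => [|i|]; [exact: measurableI|exact: measurableI|].
by rewrite /cylinder setIACA preimage_setI -bigcapI.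
Qed.

Lemma history_X1 m : measurable_fun [set: history m] (X1 : history m -> X).
Proof.
move=> _ A mA; rewrite setTI; apply: sub_sigma_algebra.
exists A, (fun=> setT); split => //.
by apply/seteqP; split => w; [move=> wA; split|case].
Qed.

Lemma history_eps m i : (i < m)%N ->
  measurable_fun [set: history m] (eps i.+2 : history m -> Y).
Proof.
move=> im _ B mB; rewrite setTI; apply: sub_sigma_algebra.
exists setT, (fun j => if j == i.+2 then B else setT); split => // [j|].
  by case: ifP.
rewrite /cylinder preimage_setT setTI; apply/seteqP; split => w.
  by move=> wB j _ /=; case: eqP => [[->]|].
by move=> /(_ i im); rewrite /= eqxx.
Qed.

Lemma measurable_history m : measurable_fun [set: Omega] (id : Omega -> history m).
Proof.
move=> _ A mA; rewrite setTI.
apply: (smallest_sub (@sigma_algebra_measurable _ Omega) _ mA).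
by move=> _ [B [C [mB mC ->]]]; exact: measurable_cylinder.
Qed.

Context (eps_indep : mutually_independent [set i | (1 <= i)%N] eps).
Context (X1_indep : independent_of_family X1 [set i | (2 <= i)%N] eps).

Lemma cylinder_probability m A B : measurable A -> (forall i, measurable (B i)) ->
  P (cylinder m A B) = P (X1 @^-1` A) * \prod_(i < m) P (eps i.+2 @^-1` B i.+2).
Proof.
move=> mA mB.
pose J := fix J m := if m is m'.+1 then (m'.+2 |` J m')%fset else (fset0 : {fset nat}).
have JE k i : (i \in J k) = (1 < i < k.+2)%N.
  elim: k => [|k IH] /=; first by rewrite in_fset0; case: i => [|[|]].
  by rewrite in_fset1U IH; lia.
have bigJ : \bigcap_(i in `I_m) eps i.+2 @^-1` B i.+2 =
            \bigcap_(i in [set` J m]) eps i @^-1` B i.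
  apply/seteqP; split => w wB i /=.
    rewrite JE; case: i => [|[|i]]//=; rewrite !ltnS => im; exact: wB.
  by move=> im; apply: wB; rewrite /= JE.
rewrite /cylinder bigJ X1_indep//; last first.
  pose G := g_sigma_algebraType (\bigcup_(i in [set i | (2 <= i)%N])
    preimage_set_system setT (eps i) measurable).
  apply: (@fin_bigcap_measurable _ G) => // i /= iJ.
  apply: sub_sigma_algebra; exists i; first by move: iJ; rewrite /= JE => /andP[].
  by exists (B i) => //; rewrite setTI.
rewrite eps_indep//; last first.
  by move=> i; rewrite /= JE => /andP[/ltnW].
congr (_ * _); elim: (m) => [|k IH]; first by rewrite big_seq_fset0 big_ord0.
rewrite big_fsetU1 /=; first by rewrite IH big_ord_recr /= muleC.
by rewrite JE ltnn andbF.
Qed.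

(** Both sides are finite measures in A that agree on the cylinders, because
    constraining one more innovation makes a cylinder of the next index. *)
Lemma history_independence m (A : set (history m)) (B : set Y) :
  measurable A -> measurable B ->
  P (A `&` eps m.+2 @^-1` B) = P A * P (eps m.+2 @^-1` B).
Proof.
move=> mA mB; have mE : measurable (eps m.+2 @^-1` B) by exact: measurable_funPTI.
have pf : P (eps m.+2 @^-1` B) \is a fin_num by exact: fin_num_measure.
have pf0 : (0 <= fine (P (eps m.+2 @^-1` B)))%R by exact: fine_ge0.
have Gm : cylinders m `<=` measurable.
  by move=> _ [C [D [mC mD ->]]]; exact: measurable_cylinder.
have cover : \bigcup_(i in [set: nat]) (fun=> [set: Omega]) i = setT.
  by rewrite -subTset => w _; exists 0%N.
have fin (i : nat) : mrestr P mE ((fun=> [set: Omega]) i) < +oo.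
  by rewrite /mrestr setTI; apply: le_lt_trans (probability_le1 _ _) _ => //; exact: ltry.
rewrite muleC -[P (eps _ @^-1` _)]fineK//.
apply: (g_sigma_algebra_measure_unique (cylinders m) Gm (fun=> setT)
  (fun=> cylindersT m) cover (mrestr P mE) (mscale (NngNum pf0) P)
  (@cylinders_setI_closed m) _ fin _ mA).
move=> _ [C [D [mC mD ->]]]; rewrite /= /mrestr /mscale /= fineK//.
pose D' i := if i == m.+2 then B else D i.
have D'E (i : 'I_m) : D' i.+2 = D i.+2 by rewrite /D' !eqSS ltn_eqF.
have mD' i : measurable (D' i) by rewrite /D'; case: ifP.
rewrite [X in P X](_ : _ = cylinder m.+1 C D'); last first.
  rewrite /cylinder -setIA; congr (_ `&` _); apply/seteqP; split => w /=.
    move=> [wD wB] i /=; rewrite ltnS leq_eqVlt /D' => /predU1P[->|im].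
      by rewrite eqxx.
    by rewrite !eqSS (ltn_eqF im); exact: wD.
  move=> wD; split; last by have := wD m (ltnSn m); rewrite /= /D' eqxx.
  move=> i im; have := wD i (ltnW im); rewrite /= /D' !eqSS ltn_eqF//.
rewrite !cylinder_probability// big_ord_recr /=.
rewrite (eq_bigr (fun i : 'I_m => P (eps i.+2 @^-1` D i.+2))) => [|i _].
  have D'm : D' m.+2 = B by rewrite /D' eqxx.
  by rewrite D'm muleA muleC.
by rewrite D'E.
Qed.

End history.

(** * Laplace transforms of functions of small oscillation *)

Section exponential_moments.
Context (R : realType).

Lemma expR_le_quadratic (u : R) : (expR u <= 1 + u + u ^+ 2 * expR `|u|)%R.
Proof.
have e1 (v : R) : (expR v <= 1 + v * expR v)%R.
  have := expR_ge1Dx (- v)%R; rewrite expRN -(ler_pM2r (expR_gt0 v)) mulVf ?gt_eqF ?expR_gt0//.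
  lra.
have ee := expR_ge1Dx u; have u2 : (0 <= u ^+ 2)%R := sqr_ge0 u.
case: (leP 0%R u) => u0.
  rewrite ger0_norm//; have := e1 u.
  have : (u * expR u <= u * (1 + u * expR u))%R by rewrite ler_wpM2l.
  lra.
have : (u * expR u <= u * (1 + u))%R by rewrite ler_wnM2l// ltW.
have : (u ^+ 2 * 1 <= u ^+ 2 * expR `|u|)%R by rewrite ler_wpM2l// -expR0 ler_expR.
have := e1 u; rewrite expr2; lra.
Qed.

Lemma sqr_le_expR (v : R) : (0 <= v)%R -> (v ^+ 2 <= 4 * expR v)%R.
Proof.
move=> v0; have -> : v = (v / 2 + v / 2)%R by lra.
rewrite expRD; have := expR_ge1Dx (v / 2)%R => h.
have : ((v / 2) * (v / 2) <= expR (v / 2) * expR (v / 2))%R by rewrite ler_pM//; lra.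
rewrite expr2; nra.
Qed.

(** The remainder u^2 exp |u| at u = t z is absorbed by exp (b h): half of
    the exponent dominates exp |t z|, the other half dominates b^2 h^2. *)
Lemma expR_le_quadratic_moment (b t z h : R) : (0 < b)%R -> (`|z| <= h)%R ->
  (`|t| <= b / 2)%R ->
  (expR (t * z) <= 1 + t * z + 16 / b ^+ 2 * t ^+ 2 * expR (b * h))%R.
Proof.
move=> b0 zh tb; apply: le_trans (expR_le_quadratic _) _; rewrite lerD2l.
have h0 : (0 <= h)%R by apply: le_trans zh.
have -> : (expR (b * h) = expR (b / 2 * h) * expR (b / 2 * h))%R.
  by rewrite -expRD; congr expR; field.
have -> : (16 / b ^+ 2 * t ^+ 2 * (expR (b / 2 * h) * expR (b / 2 * h)) =
   (t ^+ 2 * (4 / b ^+ 2 * (4 * expR (b / 2 * h)))) * expR (b / 2 * h))%R.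
  by field; rewrite gt_eqF.
rewrite ler_pM ?expR_ge0 ?sqr_ge0//.
  rewrite exprMn ler_wpM2l ?sqr_ge0//.
  apply: (@le_trans _ _ (h ^+ 2)%R).
    by rewrite -(real_normK (num_real z)) lerXn2r// nnegrE.
  have -> : (h ^+ 2 = 4 / b ^+ 2 * (b / 2 * h) ^+ 2)%R by field; rewrite gt_eqF.
  rewrite ler_wpM2l ?sqr_le_expR// ?mulr_ge0 ?invr_ge0 ?sqr_ge0//; lra.
by rewrite ler_expR normrM ler_pM.
Qed.

Context d (S : measurableType d) (Q : probability S R).

Lemma integrable_ge0 (f : S -> R) (M : R) : measurable_fun setT f ->
  (forall s, 0 <= f s)%R -> \int[Q]_s (f s)%:E <= M%:E ->
  Q.-integrable setT (EFin \o f).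
Proof.
move=> mf f0 fM; apply/integrableP; split; first exact/measurable_EFinP.
under eq_integral => s _ do rewrite /= ger0_norm//.
exact: le_lt_trans fM (ltry _).
Qed.

Lemma integrable_expR_moment (b K : R) (H : S -> R) : (0 < b)%R ->
  measurable_fun setT H -> (forall s, 0 <= H s)%R ->
  \int[Q]_s (expR (b * H s))%:E <= K%:E -> Q.-integrable setT (EFin \o H).
Proof.
move=> b0 mH H0 HK; apply: (@integrable_ge0 _ (b^-1 * K)%R) => //.
have mE : measurable_fun setT (fun s => (expR (b * H s))%:E).
  by apply/measurable_EFinP; apply: measurableT_comp => //; exact: measurable_funM.
apply: (@le_trans _ _ (\int[Q]_s (b^-1%:E * (expR (b * H s))%:E))).
  apply: ge0_le_integral => //.
  - by move=> s _; rewrite lee_fin.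
  - exact/measurable_EFinP.
  - exact: measurable_funeM.
  - move=> s _; rewrite -EFinM lee_fin mulrC ler_pdivlMr// mulrC.
    by apply: le_trans (expR_ge1Dx _); rewrite lerDr.
rewrite ge0_integralZl//; last by rewrite lee_fin invr_ge0 ltW.
by rewrite EFinM lee_wpmul2l// lee_fin invr_ge0 ltW.
Qed.

(** Integrating the previous pointwise bound kills the linear term. *)
Lemma mgf_le_gaussian (b K t : R) (H Z : S -> R) : (0 < b)%R ->
  measurable_fun setT H -> measurable_fun setT Z ->
  (forall s, `|Z s| <= H s)%R -> \int[Q]_s (expR (b * H s))%:E <= K%:E ->
  \int[Q]_s (Z s)%:E = 0 -> (`|t| <= b / 2)%R ->
  \int[Q]_s (expR (t * Z s))%:E <= (expR (16 / b ^+ 2 * K * t ^+ 2))%:E.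
Proof.
move=> b0 mH mZ ZH HK Z0 tb.
have H0 s : (0 <= H s)%R by apply: le_trans (ZH s).
have mexp (r : R) (f : S -> R) : measurable_fun setT f ->
    measurable_fun setT (fun s => expR (r * f s)).
  by move=> mf; apply: measurableT_comp => //; exact: measurable_funM.
have iH := integrable_expR_moment b0 mH H0 HK.
have iZ : Q.-integrable setT (EFin \o Z).
  apply: (le_integrable _ _ _ iH) => //; first exact/measurable_EFinP.
  by move=> s _; rewrite lee_fin (le_trans (ZH s))// ler_norm.
pose c := (16 / b ^+ 2 * t ^+ 2)%R.
have c0 : (0 <= c)%R by rewrite mulr_ge0 ?sqr_ge0// divr_ge0 ?sqr_ge0.
have iE : Q.-integrable setT (EFin \o (fun s => expR (b * H s))).
  by apply: integrable_ge0 HK => [|s]; [exact: mexp|exact: expR_ge0].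
apply: (@le_trans _ _ (\int[Q]_s ((1 + t * Z s) + c * expR (b * H s))%:E)).
  apply: ge0_le_integral => //.
  - by apply/measurable_EFinP; exact: mexp.
  - apply/measurable_EFinP; apply: measurable_funD.
      by apply: measurable_funD => //; exact: measurable_funM.
    by apply: measurable_funM => //; exact: mexp.
  - by move=> s _; rewrite lee_fin; exact: expR_le_quadratic_moment.
have i1 : Q.-integrable setT (EFin \o cst 1%R) by exact: finite_measure_integrable_cst.
have itZ : Q.-integrable setT (fun s => t%:E * (Z s)%:E) by exact: integrableZl.
have icE : Q.-integrable setT (fun s => c%:E * (expR (b * H s))%:E) by exact: integrableZl.
under eq_integral => s _ do rewrite !EFinD !EFinM.
rewrite integralD//; last exact: integrableD.
rewrite integralD// integralZl// integralZl// Z0 mule0 adde0 integral_cst//= probability_setT mule1.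
apply: (@le_trans _ _ (1 + c%:E * K%:E)).
  by rewrite leeD2l// lee_wpmul2l// lee_fin.
rewrite -EFinM -EFinD lee_fin (_ : _ * K = 16 / b ^+ 2 * K * t ^+ 2)%R; last by rewrite /c; ring.
exact: expR_ge1Dx.
Qed.

(** The deviation of phi from its mean at s is the average of phi s - phi s'
    over s', so that a bound of the oscillations needs only be averaged. *)
Lemma oscillation_bounds (phi H : S -> R) (D : S -> S -> R) :
  measurable_fun setT phi ->
  (forall s, measurable_fun setT (D s)) ->
  (forall s s', `|phi s - phi s'| <= D s s')%R ->
  (forall s, \int[Q]_s' (D s s')%:E = (H s)%:E) ->
  Q.-integrable setT (EFin \o phi) /\
  (forall s, `|phi s - \int[Q]_s' phi s'| <= H s)%R.
Proof.
move=> mphi mD phiD DH.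
have D0 s s' : (0 <= D s s')%R by apply: le_trans (phiD s s').
have iD s : Q.-integrable setT (EFin \o D s).
  by apply: (@integrable_ge0 _ (H s)) => //; rewrite DH.
have icst (r : R) : Q.-integrable setT (EFin \o cst r) by exact: finite_measure_integrable_cst.
have iphi : Q.-integrable setT (EFin \o phi).
  pose s0 := (point : S).
  apply: (@le_integrable _ _ _ _ _ _ _ (fun s => (D s0 s)%:E + (`|phi s0|)%:E)) => //.
  - exact/measurable_EFinP.
  - move=> s _; rewrite /= lee_fin [leRHS]ger0_norm ?addr_ge0//.
    have := phiD s0 s; rewrite distrC => h.
    rewrite -[X in (`|X| <= _)%R](subrK (phi s0)); apply: le_trans (ler_normD _ _) _.
    by rewrite lerD2r.
  - by apply: integrableD => //; [exact: iD|exact: (icst `|phi s0|%R)].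
split => // s.
have cstE : (phi s = \int[Q]_s' phi s)%R by rewrite Rintegral_cst//= probability_setT /= mulr1.
rewrite [X in (X - _)%R]cstE -RintegralB//; last exact: icst.
have iB : Q.-integrable setT (EFin \o (fun s' => phi s - phi s')%R).
  exact: (integrableB measurableT (icst (phi s)) iphi).
apply: le_trans (le_normr_Rintegral _ iB) _ => //.
rewrite -[leRHS]/(fine (H s)%:E) -DH -/(Rintegral Q setT (D s)).
apply: le_Rintegral => //; apply: (le_integrable _ _ _ iB) => //.
- by apply/measurable_EFinP; apply: measurableT_comp => //; exact: measurable_funB.
- by move=> s' _; rewrite /= normr_id.
Qed.

Lemma oscillation_mgf (b K t : R) (phi H : S -> R) (D : S -> S -> R) : (0 < b)%R ->
  measurable_fun setT phi -> measurable_fun setT H ->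
  (forall s, measurable_fun setT (D s)) ->
  (forall s s', `|phi s - phi s'| <= D s s')%R ->
  (forall s, \int[Q]_s' (D s s')%:E = (H s)%:E) ->
  \int[Q]_s (expR (b * H s))%:E <= K%:E -> (`|t| <= b / 2)%R ->
  \int[Q]_s (expR (t * (phi s - \int[Q]_s' phi s')))%:E
    <= (expR (16 / b ^+ 2 * K * t ^+ 2))%:E.
Proof.
move=> b0 mphi mH mD phiD DH HK tb.
have [iphi phiH] := oscillation_bounds mphi mD phiD DH.
apply: (mgf_le_gaussian b0 mH _ phiH HK) => //; first exact: measurable_funB.
under eq_integral => s _ do rewrite EFinB.
rewrite integralB//; last exact: finite_measure_integrable_cst.
rewrite integral_cst//= probability_setT mule1 /Rintegral fineK ?subee//; exact: integrable_fin_num.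
Qed.

End exponential_moments.

(** * Concentration along the chain *)

Section chain_concentration.
Context (R : realType) (X Y : completeMetricType R)
  (sepX : separable_space X) (sepY : separable_space Y).
Context (d : measure_display) (Omega : measurableType d) (P : probability Omega R).
Context (eps : nat -> {RV P >-> borel Y}) (X_ : nat -> {RV P >-> borel X})
  (F : borel X * borel Y -> borel X) (rho C : R).
Context (eps_iid : iid [set i | (1 <= i)%N] eps)
  (X1_indep : independent_of_family (X_ 1%N) [set i | (2 <= i)%N] eps)
  (F_meas : measurable_fun [set: borel X * borel Y] F)
  (X_chain : is_chain F eps X_)
  (rho_ge0 : (0 <= rho)%R) (rho_lt1 : (rho < 1)%R) (C_gt0 : (0 < C)%R).

Local Notation P_e := (distribution P (eps 1%N)).

Context (F_contract : forall x x' : X,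
  \int[P_e]_y (mdist (F (x, y) : X) (F (x', y) : X))%:E <= (rho * mdist x x')%:E).
Context (F_lip : forall (x : X) (y y' : Y),
  (mdist (F (x, y) : X) (F (x, y') : X) <= C * mdist y y')%R).
Context (GX : X -> R) (Ge : Y -> R).
Context (GXE : forall x : X,
  \int[distribution P (X_ 1%N)]_x' (mdist x (x' : X))%:E = (GX x)%:E).
Context (GeE : forall y : Y,
  \int[P_e]_y' (C * mdist y (y' : Y))%:E = (Ge y)%:E).

Let L : R := ((1 - rho)^-1)%R.

Let L_ge1 : (1 <= L)%R.
Proof. by rewrite /L invf_ge1 ?subr_gt0// lerBlDr lerDl. Qed.

Let L_ge0 : (0 <= L)%R. Proof. exact: le_trans L_ge1. Qed.

Let L_rec : (1 + rho * L = L)%R.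
Proof. by rewrite /L; field; rewrite subr_eq0 gt_eqF. Qed.

Lemma measurable_F (x : borel X) : measurable_fun setT (fun y : borel Y => F (x, y)).
Proof. by apply: measurableT_comp => //; exact: measurable_fun_pair. Qed.

Lemma measurable_GX : measurable_fun setT (GX : borel X -> R).
Proof.
apply/measurable_EFinP.
rewrite (_ : _ \o _ = fubini_F (distribution P (X_ 1%N))
    (fun z : borel X * borel X => (mdist (z.1 : X) (z.2 : X))%:E)); last first.
  by apply/funext => x; rewrite /fubini_F /= GXE.
apply: measurable_fun_fubini_tonelli_F; first exact: measurable_cost.
by move=> z; exact: cost_ge0.
Qed.

Lemma measurable_Ge : measurable_fun setT (Ge : borel Y -> R).
Proof.
apply/measurable_EFinP.
rewrite (_ : _ \o _ = fubini_F P_e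
    (fun z : borel Y * borel Y => (C * mdist (z.1 : Y) (z.2 : Y))%:E)); last first.
  by apply/funext => y; rewrite /fubini_F /= GeE.
apply: measurable_fun_fubini_tonelli_F.
  by apply/measurable_EFinP; apply: measurable_funM => //; exact: measurable_mdist.
by move=> z; rewrite lee_fin mulr_ge0 ?mdist_ge0// ltW.
Qed.

Lemma Ge_ge0 y : (0 <= Ge y)%R.
Proof.
rewrite -lee_fin -GeE; apply: integral_ge0 => y' _.
by rewrite lee_fin mulr_ge0 ?mdist_ge0// ltW.
Qed.

(** The coordinates of the path are numbered from 1; the last relevant one,
    of index k + 1, is allowed the larger constant L, which accounts for its
    influence on the coordinates that have been integrated out. *)
Definition path_lipschitz (k : nat) (g : (nat -> X) -> R) : Prop :=
  forall x x' : nat -> X, (`|g x - g x'| <=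
    \sum_(i < k) mdist (x i.+1) (x' i.+1) + L * mdist (x k.+1) (x' k.+1))%R.

Definition update (x : nat -> X) (j : nat) (v : X) : nat -> X :=
  fun i => if i == j then v else x i.

(** The conditional expectation of g given the path up to time k + 1. *)
Definition average (k : nat) (g : (nat -> X) -> R) (x : nat -> X) : R :=
  (\int[P_e]_y g (update x k.+2 (F (x k.+1, y))))%R.

Lemma path_lipschitz_measurable d' (E : measurableType d') k g
    (h : nat -> E -> borel X) : path_lipschitz k g ->
  (forall i, (i <= k)%N -> measurable_fun [set: E] (h i.+1)) ->
  measurable_fun [set: E] (fun t => g (fun i => h i t)).
Proof.
move=> gL mh; apply: (@lipschitz_measurable _ _ sepX _ _ k.+1 _ L) => //.
move=> x x'; apply: le_trans (gL x x') _; rewrite big_ord_recr /= mulrDr lerD2r.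
by rewrite ler_peMl// sumr_ge0// => i _; exact: mdist_ge0.
Qed.

Lemma measurable_update d' (E : measurableType d') (h : nat -> E -> borel X)
    (v : E -> borel X) j i :
  (i != j -> measurable_fun [set: E] (h i)) -> measurable_fun [set: E] v ->
  measurable_fun [set: E] (fun t => update (h^~ t) j (v t) i : borel X).
Proof. by rewrite /update; case: eqP => // _ /(_ isT). Qed.

Lemma update_oscillation k g x (y y' : Y) : path_lipschitz k.+1 g ->
  (`|g (update x k.+2 (F (x k.+1, y))) - g (update x k.+2 (F (x k.+1, y')))|
    <= L * (C * mdist y y'))%R.
Proof.
move=> gL; apply: le_trans (gL _ _) _.
rewrite big1 ?add0r => [|i _]; last first.
  by rewrite /update !eqSS ltn_eqF ?mdistxx.
by rewrite /update eqxx ler_wpM2l.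
Qed.

Lemma measurable_update_F k g x : path_lipschitz k.+1 g ->
  measurable_fun setT (fun y : borel Y => g (update x k.+2 (F (x k.+1, y)))).
Proof.
move=> gL; apply: (path_lipschitz_measurable (h := fun i (y : borel Y) =>
  update x k.+2 (F (x k.+1, y)) i) gL) => i _.
exact: (measurable_update (h := fun i _ => x i) _ (measurable_F _)).
Qed.

Lemma measurable_LC y : measurable_fun setT
  (fun y' : borel Y => (L * (C * mdist y (y' : Y)))%R).
Proof.
apply: measurable_funM => //; apply: measurable_funM => //.
exact: measurable_mdist.
Qed.

Lemma integral_LC y : \int[P_e]_y' (L * (C * mdist y (y' : Y)))%:E = (L * Ge y)%:E.
Proof.
under eq_integral => y' _ do rewrite EFinM.
rewrite ge0_integralZl//; last 2 first.
- by apply/measurable_EFinP; apply: measurable_funM => //; exact: measurable_mdist.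
- by move=> y' _; rewrite lee_fin mulr_ge0 ?mdist_ge0// ltW.
by rewrite GeE.
Qed.

Lemma average_oscillation k g x : path_lipschitz k.+1 g ->
  P_e.-integrable setT (EFin \o (fun y => g (update x k.+2 (F (x k.+1, y))))) /\
  (forall y, `|g (update x k.+2 (F (x k.+1, y))) - average k g x| <= L * Ge y)%R.
Proof.
move=> gL; apply: (@oscillation_bounds R _ (borel Y) P_e
  (fun y => g (update x k.+2 (F (x k.+1, y)))) (fun y => L * Ge y)%R
  (fun y y' => L * (C * mdist (y : Y) (y' : Y)))%R).
- exact: measurable_update_F.
- exact: measurable_LC.
- by move=> y y'; exact: update_oscillation.
- exact: integral_LC.
Qed.

(** Coordinate k + 1 acts directly with constant 1, and through the next
    state, where contraction turns L into rho L: in all 1 + rho L = L. *)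
Lemma average_lipschitz k g : path_lipschitz k.+1 g -> path_lipschitz k (average k g).
Proof.
move=> gL x x'; rewrite /average.
have i1 := (average_oscillation x gL).1; have i2 := (average_oscillation x' gL).1.
rewrite -RintegralB//.
have iB := integrableB measurableT i1 i2.
apply: le_trans (le_normr_Rintegral _ iB) _ => //.
set D := (\sum_(i < k) mdist (x i.+1) (x' i.+1))%R.
have mdF : measurable_fun setT
    (fun y : borel Y => mdist (F (x k.+1, y) : X) (F (x' k.+1, y) : X)).
  by apply: measurable_mdist => //; exact: measurable_F.
have D0 : (0 <= D + mdist (x k.+1) (x' k.+1))%R.
  by rewrite addr_ge0 ?mdist_ge0// sumr_ge0// => i _; exact: mdist_ge0.
rewrite -lee_fin /Rintegral fineK; last first.
  apply: integrable_fin_num => //.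
  apply: (le_integrable _ _ _ iB) => //.
    apply/measurable_EFinP; apply: measurableT_comp => //.
    by apply: measurable_funB; exact: measurable_update_F.
  by move=> y _; rewrite /= normr_id.
apply: (@le_trans _ _ (\int[P_e]_y ((D + mdist (x k.+1) (x' k.+1))%:E +
    L%:E * (mdist (F (x k.+1, y) : X) (F (x' k.+1, y) : X))%:E))).
  apply: ge0_le_integral => //.
  - apply/measurable_EFinP; apply: measurableT_comp => //.
    by apply: measurable_funB; exact: measurable_update_F.
  - by apply: emeasurable_funD => //; apply: measurable_funeM; exact/measurable_EFinP.
  - move=> y _; rewrite -EFinM -EFinD lee_fin; apply: le_trans (gL _ _) _.
    rewrite big_ord_recr /= /update eqxx eqSS ltn_eqF// lerD2r lerD2r.
    by apply: ler_sum => i _; rewrite eqSS ltn_eqF// ltnW// ltnS.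
rewrite ge0_integralD//; last 2 first.
- by move=> y _; rewrite -EFinM lee_fin mulr_ge0 ?mdist_ge0.
- by apply: measurable_funeM; exact/measurable_EFinP.
rewrite integral_cst//= probability_setT mule1 ge0_integralZl//; last 2 first.
- exact/measurable_EFinP.
- by move=> y _; rewrite lee_fin mdist_ge0.
apply: (@le_trans _ _ ((D + mdist (x k.+1) (x' k.+1))%:E +
   L%:E * (rho * mdist (x k.+1) (x' k.+1))%:E)).
  by rewrite leeD2l// lee_wpmul2l// lee_fin.
rewrite -EFinM -EFinD lee_fin -{2}L_rec; lra.
Qed.

Local Notation hist := (history (X_ 1%N) eps).

Lemma history_chain k i : (i <= k)%N ->
  measurable_fun [set: hist k] (X_ i.+1 : hist k -> borel X).
Proof.
elim: i => [_|i IH ik]; first exact: history_X1.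
rewrite (_ : (X_ i.+2 : hist k -> borel X) = (fun w => F (X_ i.+1 w, eps i.+2 w))); last first.
  by apply/funext => w; exact: X_chain.
apply: (measurableT_comp F_meas); apply: measurable_fun_pair.
  by apply: IH; exact: ltnW.
exact: history_eps.
Qed.

Lemma innovation_law k B : measurable B ->
  P (eps k.+2 @^-1` B) = distribution P (eps 1%N) B.
Proof. by move=> mB; apply/esym; apply: eps_iid.2. Qed.

(** The outer integrals are over Omega with its own sigma-algebra, although
    the integrands are measurable for the coarser one of the past. *)
Lemma chain_freezing k (f : hist k * borel Y -> \bar R) :
  measurable_fun setT f -> (forall z, 0 <= f z) ->
  \int[P]_(w in [set: Omega]) f (w, eps k.+2 w) =
  \int[P]_(w in [set: Omega]) \int[P_e]_y f (w, y).
Proof.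
move=> mf f0.
have indep (A : set (hist k)) (B : set (borel Y)) : measurable A -> measurable B ->
    P (id @^-1` A `&` eps k.+2 @^-1` B) = P (id @^-1` A) * distribution P (eps 1%N) B.
  move=> mA mB; rewrite preimage_id (history_independence eps_iid.1 X1_indep)//.
  by rewrite innovation_law.
exact: (@freezing d _ _ Omega (hist k) (borel Y) R P id (eps k.+2) P_e f
  (@measurable_history _ _ _ P _ _ _ _ (X_ 1%N) eps k) indep mf f0).
Qed.

Lemma innovation_integral k (f : borel Y -> \bar R) :
  measurable_fun setT f -> (forall y, 0 <= f y) ->
  \int[P]_w f (eps k.+2 w) = \int[P_e]_y f y.
Proof.
move=> mf f0; rewrite -(@ge0_integral_distribution _ _ _ _ _ P)//.
by apply: eq_measure_integral => B mB _; exact: innovation_law.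
Qed.

(** X_ 1, eps 2, ..., eps k.+1 are independent: the innovations are
    integrated out one at a time. *)
Lemma exp_sum_moment (psi0 : borel X -> R) (psi : borel Y -> R) (M : R) (k : nat) :
  measurable_fun setT psi0 -> measurable_fun setT psi -> (0 <= M)%R ->
  \int[P]_w (expR (psi0 (X_ 1%N w)))%:E <= M%:E ->
  \int[P_e]_y (expR (psi y))%:E <= M%:E ->
  \int[P]_w (expR (psi0 (X_ 1%N w) + \sum_(i < k) psi (eps i.+2 w)))%:E
    <= (M ^+ k.+1)%:E.
Proof.
move=> mpsi0 mpsi M0 M1 M2; elim: k => [|k IH].
  by under eq_integral => w _ do rewrite big_ord0 addr0; rewrite expr1.
pose A (w : Omega) := (psi0 (X_ 1%N w) + \sum_(i < k) psi (eps i.+2 w))%R.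
have mA : measurable_fun [set: hist k] A.
  apply: measurable_funD; first exact: (measurableT_comp mpsi0 (history_chain (leq0n k))).
  pose psii (i : 'I_k) (w : hist k) := psi (eps i.+2 w).
  apply: (@measurable_sum _ _ _ _ _ _ psii) => i.
  have mei : measurable_fun [set: hist k] (eps i.+2 : hist k -> borel Y).
    exact: history_eps.
  exact: (measurableT_comp mpsi mei).
have mA' : measurable_fun [set: Omega] A.
  exact: (measurableT_comp mA (@measurable_history _ _ _ P _ _ _ _ (X_ 1%N) eps k)).
pose f (z : hist k * borel Y) := (expR (A z.1) * expR (psi z.2))%:E.
have mf : measurable_fun setT f.
  apply/measurable_EFinP; apply: measurable_funM; apply: measurableT_comp => //.
    exact: (measurableT_comp mA).
  exact: (measurableT_comp mpsi).
have f0 z : 0 <= f z by rewrite lee_fin mulr_ge0// expR_ge0.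
rewrite (eq_integral (fun w : Omega => f (w, eps k.+2 w))); last first.
  by move=> w _; rewrite /f /A /= big_ord_recr /= addrA !expRD.
rewrite (chain_freezing mf f0) exprS.
have mexpA : measurable_fun [set: Omega] (fun w => (expR (A w))%:E).
  by apply/measurable_EFinP; apply: measurableT_comp.
have mexppsi : measurable_fun [set: borel Y] (fun y => (expR (psi y))%:E).
  by apply/measurable_EFinP; apply: measurableT_comp.
apply: (@le_trans _ _ (\int[P]_w (M%:E * (expR (A w))%:E))).
  rewrite (eq_integral (fun w : Omega => (\int[P_e]_y (expR (psi y))%:E) * (expR (A w))%:E)).
    apply: ge0_le_integral => //.
    - move=> w _; apply: mule_ge0; last by rewrite lee_fin expR_ge0.
      by apply: integral_ge0 => y _; rewrite lee_fin expR_ge0.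
    - exact: measurable_funeM.
    - exact: measurable_funeM.
    - by move=> w _; rewrite lee_wpmul2r// lee_fin expR_ge0.
  move=> w _; rewrite /f /=; under eq_integral => y _ do rewrite EFinM.
  by rewrite ge0_integralZl// muleC.
rewrite ge0_integralZl//.
by rewrite EFinM lee_wpmul2l.
Qed.

Context (b K : R) (b_gt0 : (0 < b)%R).
Context (X1_exp : \int[P]_w (expR (b * (L * GX (X_ 1%N w))))%:E <= K%:E).
Context (eps_exp : \int[P_e]_y (expR (b * (L * Ge y)))%:E <= K%:E).

Definition increment_bound (i : nat) (w : Omega) : R :=
  if i is j.+1 then (L * Ge (eps j.+2 w))%R else (L * GX (X_ 1%N w))%R.

Local Notation path w := (fun i => X_ i w : X).

Definition concentrated (k : nat) (g : (nat -> X) -> R) (m0 : R) :=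
  [/\ P.-integrable setT (EFin \o (fun w => g (path w))),
      \int[P]_w (g (path w))%:E = m0%:E,
      forall w, (`|g (path w) - m0| <= \sum_(i < k.+1) increment_bound i w)%R &
      forall t, (`|t| <= b / 2)%R ->
        \int[P]_w (expR (t * (g (path w) - m0)))%:E
          <= (expR (k.+1%:R * (16 / b ^+ 2 * K * t ^+ 2)))%:E].

Lemma chain_concentration0 g : path_lipschitz 0 g ->
  concentrated 0 g (\int[P]_w g (path w)).
Proof.
move=> gL.
have gL0 x x' : (`|g x - g x'| <= L * mdist (x 1%N) (x' 1%N))%R.
  by have := gL x x'; rewrite big_ord0 add0r.
have mg : measurable_fun setT (fun w => g (path w)).
  apply: (path_lipschitz_measurable (h := X_) gL) => -[|//] _.
  exact: measurable_funP.
pose D (w w' : Omega) := (L * mdist (X_ 1%N w : X) (X_ 1%N w' : X))%R.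
have mD w : measurable_fun setT (D w).
  by apply: measurable_funM => //; apply: measurable_mdist.
have DH w : \int[P]_w' (D w w')%:E = (L * GX (X_ 1%N w))%:E.
  under eq_integral => w' _ do rewrite EFinM.
  rewrite ge0_integralZl//; last 2 first.
  - by apply/measurable_EFinP; exact: measurable_mdist.
  - by move=> w' _; rewrite lee_fin mdist_ge0.
  rewrite EFinM; congr (_ * _); rewrite -GXE ge0_integral_distribution//.
  - by apply/measurable_EFinP; exact: measurable_mdist.
  - by move=> x; rewrite lee_fin mdist_ge0.
have gD w w' : (`|g (path w) - g (path w')| <= D w w')%R by exact: gL0.
have [ig gm] := oscillation_bounds mg mD gD DH.
split => //.
- by rewrite /Rintegral fineK//; exact: integrable_fin_num.
- by move=> w; rewrite big_ord1; exact: gm.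
- move=> t tb; rewrite mul1r.
  apply: (oscillation_mgf b_gt0 mg _ mD gD DH X1_exp tb).
  apply: measurable_funM => //; apply: (measurableT_comp measurable_GX).
  exact: measurable_funP.
Qed.

(** Induction on k, through the average h of g. Given the past, g - h is a
    centred function of the next innovation; freezing the past adds its
    bounds to those of h. *)
Lemma chain_concentration k g : path_lipschitz k g ->
  exists m0, concentrated k g m0.
Proof.
elim: k g => [g gL|k IH g gL]; first by eexists; exact: chain_concentration0.
have [m0 [ih hm hb hexp]] := IH _ (average_lipschitz gL).
exists m0.
set h := average k g in ih hm hb hexp.
(* g along the chain, with the last innovation as a free variable *)
pose Phi (z : hist k * borel Y) : R :=
  g (update (path z.1) k.+2 (F (X_ k.+1 z.1, z.2))).
have gPhi w : g (path w) = Phi (w, eps k.+2 w).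
  congr g; apply/funext => i; rewrite /update; case: eqP => // ->.
  exact: X_chain.
have mh : measurable_fun [set: hist k] (fun w => h (path w)).
  apply: (path_lipschitz_measurable (h := fun i (w : hist k) => X_ i w) (average_lipschitz gL)).
  by move=> i ik; exact: history_chain.
have mPhi : measurable_fun setT Phi.
  apply: (path_lipschitz_measurable (h := fun i (z : hist k * borel Y) =>
    update (path z.1) k.+2 (F (X_ k.+1 z.1, z.2)) i) gL) => i ik.
  have mX j : (j <= k)%N ->
      measurable_fun setT (fun z : hist k * borel Y => X_ j.+1 z.1 : borel X).
    by move=> jk; apply: (measurableT_comp (history_chain jk)).
  apply: (measurable_update (h := fun i (z : hist k * borel Y) => X_ i z.1)).
    by move=> ik2; apply: mX; move: ik ik2; rewrite leq_eqVlt => /predU1P[->|]; rewrite ?eqxx.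
  by apply: (measurableT_comp F_meas); apply: measurable_fun_pair => //; exact: mX.
have mPhiw w : measurable_fun setT (fun y : borel Y => Phi (w, y)).
  exact: measurable_update_F (path w) gL.
have osc w := average_oscillation (path w) gL.
have Phib w y : (`|Phi (w, y) - h (path w)| <= L * Ge y)%R by exact: (osc w).2.
have iPhi w : P_e.-integrable setT (EFin \o (fun y => Phi (w, y))) by exact: (osc w).1.
have Phim w : (\int[P_e]_y Phi (w, y) = h (path w))%R by [].
have iGe : P_e.-integrable setT (EFin \o (fun y => L * Ge y)%R).
  apply: (integrable_expR_moment b_gt0 _ _ eps_exp).
    by apply: measurable_funM => //; exact: measurable_Ge.
  by move=> y; rewrite mulr_ge0// Ge_ge0.
have mLGe : measurable_fun setT (fun y : borel Y => L * Ge y)%R.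
  by apply: measurable_funM => //; exact: measurable_Ge.
have PhiE w : \int[P_e]_y (Phi (w, y))%:E = (h (path w))%:E.
  rewrite -Phim /Rintegral fineK//; exact: (integrable_fin_num _ (iPhi w)).
have mg : measurable_fun setT (fun w => g (path w)).
  by apply: (path_lipschitz_measurable (h := X_) gL) => i _; exact: measurable_funP.
have mLGeeps : measurable_fun setT (fun w => L * Ge (eps k.+2 w))%R.
  by apply: (measurableT_comp mLGe); exact: measurable_funP.
have iLGe : P.-integrable setT (EFin \o (fun w => L * Ge (eps k.+2 w))%R).
  apply: (integrable_expR_moment (b := b) (K := K) b_gt0) => //.
    by move=> w; rewrite mulr_ge0// Ge_ge0.
  rewrite (innovation_integral k (f := fun y => (expR (b * (L * Ge y)))%:E))//.
  by apply/measurable_EFinP; apply: measurableT_comp => //; exact: measurable_funM.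
have ig : P.-integrable setT (EFin \o (fun w => g (path w))).
  apply: (@le_integrable _ _ _ P _ _ _
    (fun w => (`|h (path w)|)%:E + (L * Ge (eps k.+2 w))%:E)) => //.
  - exact/measurable_EFinP.
  - move=> w _; rewrite /= lee_fin [leRHS]ger0_norm; last first.
      by rewrite addr_ge0// mulr_ge0// Ge_ge0.
    rewrite -[X in (`|X| <= _)%R](subrK (h (path w))); apply: le_trans (ler_normD _ _) _.
    by rewrite [leRHS]addrC lerD2r gPhi Phib.
  - by apply: integrableD => //; exact: integrable_norm.
split => //.
(* adding the bound L * Ge makes the integrand nonnegative, as freezing requires *)
- have Z0 w y : (0 <= Phi (w, y) - h (path w) + L * Ge y)%R.
    by have := Phib w y; rewrite ler_norml => /andP[+ _]; lra.
  pose f (z : hist k * borel Y) := (Phi z - h (path z.1) + L * Ge z.2)%R.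
  have mf : measurable_fun setT f.
    apply: measurable_funD.
      by apply: measurable_funB => //; exact: (measurableT_comp mh).
    exact: (measurableT_comp mLGe).
  have := @chain_freezing k (EFin \o f).
  have -> : \int[P]_(w in [set: Omega]) (EFin \o f) (w, eps k.+2 w) =
      \int[P]_w (g (path w))%:E - m0%:E + \int[P_e]_y (L * Ge y)%:E.
    rewrite -hm -(innovation_integral k); last 2 first.
    - exact/measurable_EFinP.
    - by move=> y; rewrite lee_fin mulr_ge0// Ge_ge0.
    rewrite -integralB// -integralD//; last exact: integrableB.
    by apply: eq_integral => w _; rewrite gPhi.
  have -> : \int[P]_(w in [set: Omega]) \int[P_e]_y (EFin \o f) (w, y) =
      \int[P_e]_y (L * Ge y)%:E.
    have icst (w : Omega) : P_e.-integrable setT (fun=> (h (path w))%:E).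
      exact: finite_measure_integrable_cst.
    rewrite (eq_integral (cst (\int[P_e]_y (L * Ge y)%:E))); last first.
      move=> w _ /=.
      under eq_integral => y _ do rewrite /f /= EFinD EFinB.
      rewrite integralD//; last first.
        exact: (integrableB measurableT (iPhi w) (icst w)).
      rewrite (integralB measurableT (iPhi w) (icst w)).
      by rewrite PhiE integral_cst//= probability_setT mule1 subee// add0e.
    by rewrite integral_cst//= probability_setT mule1.
  have fin : \int[P_e]_y (L * Ge y)%:E \is a fin_num by exact: integrable_fin_num.
  have mf' : measurable_fun setT (EFin \o f) by exact/measurable_EFinP.
  have f0 z : 0 <= (EFin \o f) z by case: z => w y; rewrite lee_fin; exact: Z0.
  move=> /(_ mf' f0).
  have fing : \int[P]_w (g (path w))%:E \is a fin_num by exact: (integrable_fin_num measurableT ig).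
  rewrite -(fineK fin) -(fineK fing) -EFinB -EFinD => -[h0]; congr EFin; lra.
- move=> w; rewrite big_ord_recr /=.
  have -> : (g (path w) - m0 = (g (path w) - h (path w)) + (h (path w) - m0))%R.
    by ring.
  by apply: le_trans (ler_normD _ _) _; rewrite [leRHS]addrC lerD// gPhi Phib.
- move=> t tb.
  pose f (z : hist k * borel Y) := expR (t * (Phi z - m0)).
  have mf : measurable_fun setT f.
    apply: measurableT_comp => //; apply: measurable_funM => //.
    exact: measurable_funB.
  have := @chain_freezing k (EFin \o f).
  have -> : \int[P]_(w in [set: Omega]) (EFin \o f) (w, eps k.+2 w) =
      \int[P]_w (expR (t * (g (path w) - m0)))%:E.
    by apply: eq_integral => w _; rewrite gPhi.
  move=> ->; last 2 first.
  - exact/measurable_EFinP.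
  - by move=> z; rewrite lee_fin expR_ge0.
  set c := (16 / b ^+ 2 * K * t ^+ 2)%R.
  have mexph : measurable_fun setT (fun w => (expR (t * (h (path w) - m0)))%:E).
    apply/measurable_EFinP; apply: measurableT_comp => //; apply: measurable_funM => //.
    apply: measurable_funB => //.
    apply: (path_lipschitz_measurable (h := X_) (average_lipschitz gL)) => i _.
    exact: measurable_funP.
  apply: (@le_trans _ _ (\int[P]_w ((expR c)%:E * (expR (t * (h (path w) - m0)))%:E))).
    apply: ge0_le_integral => //.
    - by move=> w _; apply: integral_ge0 => y _; rewrite lee_fin expR_ge0.
    - have mF : measurable_fun [set: hist k] (fubini_F P_e (EFin \o f)).
        apply: measurable_fun_fubini_tonelli_F; first exact/measurable_EFinP.
        by move=> z; rewrite lee_fin expR_ge0.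
      exact: (measurableT_comp mF (@measurable_history _ _ _ P _ _ _ _ (X_ 1%N) eps k)).
    - exact: measurable_funeM.
    - move=> w _.
      have -> : \int[P_e]_y (EFin \o f) (w, y) = (expR (t * (h (path w) - m0)))%:E *
          \int[P_e]_y (expR (t * (Phi (w, y) - \int[P_e]_y' Phi (w, y'))))%:E.
        have mE : measurable_fun setT (fun y : borel Y =>
            (expR (t * (Phi (w, y) - \int[P_e]_y' Phi (w, y'))))%:E).
          apply/measurable_EFinP; apply: measurableT_comp => //; apply: measurable_funM => //.
          by apply: measurable_funB => //; exact: mPhiw.
        rewrite -ge0_integralZl//.
        apply: eq_integral => y _ /=; rewrite -EFinM -expRD Phim; congr (expR _)%:E.
        by ring.
      rewrite muleC lee_wpmul2r ?lee_fin ?expR_ge0//.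
      apply: (@oscillation_mgf R _ (borel Y) P_e b K t (fun y => Phi (w, y))
        (fun y => L * Ge y)%R (fun y y' => L * (C * mdist (y : Y) (y' : Y)))%R) => //.
      - exact: measurable_LC.
      - by move=> y y'; exact: update_oscillation.
      - exact: integral_LC.
  rewrite ge0_integralZl//.
  apply: (@le_trans _ _ ((expR c)%:E * (expR (k.+1%:R * c))%:E)).
    by rewrite lee_wpmul2l// ?lee_fin ?expR_ge0//; exact: hexp.
  by rewrite -EFinM -expRD lee_fin ler_expR -[k.+2%:R]natr1 mulrDl mul1r addrC.
Qed.

End chain_concentration.

(** * Gaussian and power regimes *)

Section two_regimes.
Context (R : realType).

(** The graph of a convex power lies above its tangent at x. With
    s = x exp v it reduces to (1 - v) exp v <= 1. *)
Lemma powR_tangent (p s x : R) : (1 <= p)%R -> (0 <= s)%R -> (0 < x)%R ->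
  (x `^ p + p * x `^ (p - 1) * (s - x) <= s `^ p)%R.
Proof.
move=> p1 s0 x0; have p0 : (0 < p)%R by exact: lt_le_trans p1.
set u := (x `^ (p - 1))%R; have u0 : (0 < u)%R by exact: powR_gt0.
have xp : (x `^ p = u * x)%R.
  have := @powRD _ x (p - 1) 1; rewrite subrK => ->.
    by rewrite powRr1// ltW.
  by rewrite gt_eqF ?implybT// gt_eqF.
move: s0; rewrite le_eqVlt => /predU1P[<-|s0].
  rewrite powR0 ?gt_eqF// xp.
  have : (0 <= (p - 1) * (u * x))%R by rewrite mulr_ge0 ?subr_ge0// mulr_ge0// ltW.
  lra.
pose v := ln (s / x); have sx : (s = x * expR v)%R.
  by rewrite /v lnK ?posrE ?divr_gt0// mulrCA mulfV ?mulr1// gt_eqF.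
have sp : (s `^ p = u * x * (expR v * expR (v * (p - 1))))%R.
  rewrite sx powRM ?expR_ge0 ?(ltW x0)// xp -expRM -expRD; congr (_ * expR _)%R; ring.
have key : (1 + p * (expR v - 1) <= expR v * expR (v * (p - 1)))%R.
  have e0 := expR_gt0 v.
  have : (expR v * (1 + v * (p - 1)) <= expR v * expR (v * (p - 1)))%R.
    by rewrite ler_pM2l// expR_ge1Dx.
  have h2 : (expR v * (1 - v) <= 1)%R.
    by have := expR_ge1Dx (- v)%R; rewrite expRN -(ler_pM2l e0) mulfV// gt_eqF.
  have : (0 <= (p - 1) * (1 - expR v * (1 - v)))%R by rewrite mulr_ge0// subr_ge0.
  lra.
rewrite sp xp [in leLHS]sx.
have -> : (u * x + p * u * (x * expR v - x) = u * x * (1 + p * (expR v - 1)))%R by ring.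
by rewrite ler_wpM2l// mulr_ge0// ltW.
Qed.

Lemma sum_powR_ge (n : nat) (p x : R) (s : nat -> R) : (1 <= p)%R -> (0 < x)%R ->
  (forall i, 0 <= s i)%R -> (n%:R * x <= \sum_(i < n) s i)%R ->
  (n%:R * x `^ p <= \sum_(i < n) s i `^ p)%R.
Proof.
move=> p1 x0 s0 nx; apply: (@le_trans _ _
    (\sum_(i < n) (x `^ p + p * x `^ (p - 1) * (s i - x)))%R); last first.
  by apply: ler_sum => i _; exact: powR_tangent.
rewrite big_split /= sumr_const card_ord -mulr_sumr sumrB sumr_const card_ord.
rewrite -[(x `^ p *+ n)%R]mulr_natl -[(x *+ n)%R]mulr_natl lerDl mulr_ge0 ?subr_ge0//.
by rewrite mulr_ge0 ?powR_ge0// (le_trans _ p1).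
Qed.

Context d (Omega : measurableType d) (P : probability Omega R).

Lemma probability_le_integral (A : set Omega) (f : Omega -> R) : measurable A ->
  measurable_fun setT f -> (forall w, 0 <= f w)%R -> (forall w, A w -> 1 <= f w)%R ->
  P A <= \int[P]_w (f w)%:E.
Proof.
move=> mA mf f0 f1; rewrite -[A in leLHS]setIT -integral_indic//.
apply: ge0_le_integral => //; [exact/measurable_EFinP|exact/measurable_EFinP|].
move=> w _; rewrite lee_fin indicE; case: (boolP (w \in A)) => // /set_mem; exact: f1.
Qed.

Context (n : nat) (S : Omega -> R) (mS : measurable_fun setT S).

Let mexp (t : R) : measurable_fun setT (fun w => expR (t * S w)).
Proof. by apply: measurableT_comp => //; exact: measurable_funM. Qed.

Lemma measurable_deviation (y : R) : measurable [set w | (y < `|S w|)%R].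
Proof.
rewrite -[X in measurable X]setTI -[X in _ `&` X]preimage_true.
by apply: measurable_fun_ltr => //; exact: measurableT_comp.
Qed.

(** Both tails at once: on the event, one of exp (t (S - n x)) and
    exp (t (- S - n x)) is at least 1. *)
Lemma chernoff (c t x : R) : (0 <= t)%R ->
  (forall t', (`|t'| <= t)%R ->
    \int[P]_w (expR (t' * S w))%:E <= (expR (n%:R * (c * t' ^+ 2)))%:E) ->
  P [set w | (n%:R * x < `|S w|)%R] <= (2 * expR (- (n%:R * (t * x - c * t ^+ 2))))%:E.
Proof.
move=> t0 mgf.
pose E := expR (- (t * (n%:R * x))).
apply: (@le_trans _ _ (\int[P]_w (E * (expR (t * S w) + expR (- t * S w)))%:E)).
  apply: probability_le_integral.
  - exact: measurable_deviation.
  - by apply: measurable_funM => //; exact: measurable_funD.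
  - by move=> w; rewrite mulr_ge0 ?expR_ge0// addr_ge0// expR_ge0.
  - move=> w /= nx; rewrite mulrDr -!expRD.
    have e1 (a : R) : (0 <= a)%R -> (1 <= expR a)%R by move=> a0; rewrite -expR0 ler_expR.
    have [S0|S0] := leP 0%R (S w).
      rewrite ler_wpDr ?expR_ge0// e1//; move: nx; rewrite ger0_norm// => nx.
      have : (t * (n%:R * x) <= t * S w)%R by rewrite ler_wpM2l// ltW.
      lra.
    rewrite ler_wpDl ?expR_ge0// e1//; move: nx; rewrite ltr0_norm// => nx.
    have : (t * (n%:R * x) <= t * - S w)%R by rewrite ler_wpM2l// ltW.
    lra.
under eq_integral => w _ do rewrite EFinM EFinD.
rewrite ge0_integralZl//; last 3 first.
- by apply: emeasurable_funD; exact/measurable_EFinP.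
- by move=> w _; rewrite -EFinD lee_fin addr_ge0// expR_ge0.
- by rewrite lee_fin expR_ge0.
rewrite ge0_integralD//; last 2 first.
- exact/measurable_EFinP.
- exact/measurable_EFinP.
have t1 := mgf t; have t2 := mgf (- t)%R.
rewrite normrN ger0_norm// sqrrN in t1 t2.
apply: (@le_trans _ _ (E%:E * ((expR (n%:R * (c * t ^+ 2)))%:E + (expR (n%:R * (c * t ^+ 2)))%:E))).
  by rewrite lee_wpmul2l// ?lee_fin ?expR_ge0//; apply: leeD; [exact: t1|exact: t2].
rewrite -EFinD -EFinM lee_fin /E.
have -> : (- (n%:R * (t * x - c * t ^+ 2)) =
    - (t * (n%:R * x)) + n%:R * (c * t ^+ 2))%R by ring.
by rewrite expRD; lra.
Qed.

(** The condition on x makes half of the exponent absorb the factor M ^ n. *)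
Lemma power_regime (H : nat -> Omega -> R) (p alpha M x : R) :
  (1 <= p)%R -> (0 < x)%R -> (0 < alpha)%R -> (0 < M)%R ->
  (ln M <= alpha / 2 * x `^ p)%R ->
  (forall i, measurable_fun setT (H i)) -> (forall i w, 0 <= H i w)%R ->
  (forall w, `|S w| <= \sum_(i < n) H i w)%R ->
  \int[P]_w (expR (alpha * \sum_(i < n) H i w `^ p))%:E <= (M ^+ n)%:E ->
  P [set w | (n%:R * x < `|S w|)%R] <= (expR (- (n%:R * (alpha / 2) * x `^ p)))%:E.
Proof.
move=> p1 x0 alpha0 M0 Mx mH H0 SH HM.
pose E := expR (- (alpha * (n%:R * x `^ p))).
have mA : measurable_fun setT (fun w => expR (alpha * \sum_(i < n) H i w `^ p)).
  apply: measurableT_comp => //; apply: measurable_funM => //.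
  apply: measurable_sum => i; exact: (measurableT_comp (measurable_powR _) (mH i)).
apply: (@le_trans _ _ (\int[P]_w (E * expR (alpha * \sum_(i < n) H i w `^ p))%:E)).
  apply: probability_le_integral.
  - exact: measurable_deviation.
  - exact: measurable_funM.
  - by move=> w; rewrite mulr_ge0 ?expR_ge0.
  - move=> w /= nx; rewrite -expRD -[leLHS]expR0 ler_expR.
    have : (n%:R * x `^ p <= \sum_(i < n) H i w `^ p)%R.
      apply: (@sum_powR_ge n p x (fun i => H i w)) => //.
      by apply: le_trans (SH w); exact: ltW.
    rewrite -(ler_pM2l alpha0); lra.
under eq_integral => w _ do rewrite EFinM.
rewrite ge0_integralZl//; last 2 first.
- exact/measurable_EFinP.
- by rewrite lee_fin expR_ge0.
apply: (@le_trans _ _ (E%:E * (M ^+ n)%:E)).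
  by rewrite lee_wpmul2l// lee_fin expR_ge0.
rewrite -EFinM lee_fin /E -[M in (M ^+ n)%R]lnK ?posrE// -expRM_natl -expRD ler_expR.
have : (n%:R * ln M <= n%:R * (alpha / 2 * x `^ p))%R by rewrite ler_wpM2l.
lra.
Qed.

End two_regimes.

(** * Potentials and the theorem *)

Section potentials.
Context (R : realType) d (Omega : measurableType d) (P : probability Omega R).

Lemma expeR_moment_finite_point (G : Omega -> \bar R) (a p K : R) :
  (0 < a)%R -> (1 <= p)%R -> (forall w, 0 <= G w) ->
  \int[P]_w expeR (a%:E * (G w `^ p)) <= K%:E -> exists w, G w < +oo.
Proof.
move=> a0 p1 G0 GK; have [//|nG] := pselect (exists w, G w < +oo).
have GE w : expeR (a%:E * (G w `^ p)) = +oo.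
  have -> : G w = +oo.
    by apply/eqP; rewrite -leye_eq leNgt; apply/negP => Gw; apply: nG; exists w.
  by rewrite poweRyr ?gt_eqF ?(lt_le_trans ltr01)// gt0_muley ?lte_fin.
move: GK; under eq_integral => w _ do rewrite GE.
by rewrite integral_cst//= probability_setT mule1.
Qed.

Context (T : completeMetricType R) (sepT : separable_space T).

Lemma potential_finite (Q : probability (borel T) R) (c : R) (y0 : T) : (0 <= c)%R ->
  \int[Q]_y' (c * mdist y0 (y' : T))%:E < +oo ->
  forall y : T, \int[Q]_y' (c * mdist y (y' : T))%:E \is a fin_num.
Proof.
move=> c0 y0fin y.
have mD z : measurable_fun setT (fun y' : borel T => (c * mdist z (y' : T))%:E).
  by apply/measurable_EFinP; apply: measurable_funM => //; exact: measurable_mdist.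
have D0 z y' : 0 <= (c * mdist z (y' : T))%:E by rewrite lee_fin mulr_ge0 ?mdist_ge0.
rewrite ge0_fin_numE; last exact: integral_ge0.
apply: (@le_lt_trans _ _ (\int[Q]_y' ((c * mdist y y0)%:E + (c * mdist y0 (y' : T))%:E))).
  apply: ge0_le_integral => //.
  - by apply: emeasurable_funD => //; exact: mD.
  - by move=> y' _; rewrite -EFinD lee_fin -mulrDr ler_wpM2l// metric_triangle.
rewrite ge0_integralD//.
by rewrite integral_cst//= probability_setT mule1 lte_add_pinfty// ltry.
Qed.

(** Since u <= 1 + u^p for u >= 0. *)
Lemma exp_moment_linear (e : Omega -> R) (a p K : R) : (0 < a)%R -> (1 <= p)%R ->
  (forall w, 0 <= e w)%R -> measurable_fun setT e ->
  \int[P]_w (expR (a * e w `^ p))%:E <= K%:E ->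
  \int[P]_w (expR (a * e w))%:E <= (expR a * K)%:E.
Proof.
move=> a0 p1 e0 me HK.
have mep : measurable_fun setT (fun w => (expR (a * e w `^ p))%:E).
  apply/measurable_EFinP; apply: measurableT_comp => //; apply: measurable_funM => //.
  exact: (measurableT_comp (measurable_powR _) me).
apply: (@le_trans _ _ (\int[P]_w ((expR a)%:E * (expR (a * e w `^ p))%:E))).
  apply: ge0_le_integral => //.
  - by apply/measurable_EFinP; apply: measurableT_comp => //; exact: measurable_funM.
  - exact: measurable_funeM.
  - move=> w _; rewrite -EFinM -expRD lee_fin ler_expR -[X in (_ <= X + _)%R]mulr1 -mulrDr.
    rewrite ler_pM2l//; have [e1|e1] := leP 1%R (e w).
      by apply: le_trans (le1r_powR e1 p1) _; rewrite lerDr.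
    by apply: le_trans (ltW e1) _; rewrite lerDl powR_ge0.
by rewrite ge0_integralZl// EFinM lee_wpmul2l// lee_fin expR_ge0.
Qed.

End potentials.

Theorem mainTheorem18 (R : realType) (X Y : completeMetricType R)
  (sepX : separable_space X) (sepY : separable_space Y)
  (d : measure_display) (Omega : measurableType d) (P : probability Omega R)
  (eps : nat -> {RV P >-> borel Y}) (X_ : nat -> {RV P >-> borel X})
  (F : borel X * borel Y -> borel X) (rho C : R)
  (mu : probability (borel X) R)
  (eps_iid : iid [set i | (1 <= i)%N] eps)
  (X1_indep : independent_of_family (X_ 1%N) [set i | (2 <= i)%N] eps)
  (F_meas : measurable_fun [set: borel X * borel Y] F)
  (X_chain : is_chain F eps X_)
  (rho_ge0 : (0 <= rho)%R) (rho_lt1 : (rho < 1)%R) (C_gt0 : (0 < C)%R)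
  (F_contract : forall x x' : X,
    \int[P]_w (mdist (F (x, eps 1%N w) : X) (F (x', eps 1%N w) : X))%:E
      <= (rho * mdist x x')%:E)
  (F_lip : forall (x : X) (y y' : Y),
    (mdist (F (x, y) : X) (F (x, y') : X) <= C * mdist y y')%R)
  (mu_inv : invariant_distribution F (distribution P (eps 1%N)) mu)
  (p : R) (p_ge1 : (1 <= p)%R)
  (a K1 K2 : R) (a_gt0 : (0 < a)%R) (K1_ge1 : (1 <= K1)%R) (K2_ge1 : (1 <= K2)%R)
  (X1_moment :
    \int[P]_w expeR (a%:E * (G_X1 (X_ 1%N) (X_ 1%N w) `^ p)) <= K1%:E)
  (eps_moment :
    \int[P]_w expeR (a%:E * (G_eps C (eps 1%N) (eps 1%N w) `^ p)) <= K2%:E) :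
  exists A B C0 : R, [/\ (0 < A)%R, (0 < B)%R, (0 < C0)%R &
    forall (n : nat) (x : R), (1 <= n)%N ->
      ((C0 <= x)%R ->
        P [set w | x%:E < W1_deviation X_ mu n w]
          <= (2 * expR (- (n%:R * A * x `^ p)))%:E) /\
      ((0 <= x <= C0)%R ->
        P [set w | x%:E < W1_deviation X_ mu n w]
          <= (2 * expR (- (n%:R * B * x ^+ 2)))%:E)].
Proof.
pose P_e := distribution P (eps 1%N).
have contract x x' : \int[P_e]_y (mdist (F (x, y) : X) (F (x', y) : X))%:E
    <= (rho * mdist x x')%:E.
  apply: le_trans (F_contract x x'); rewrite ge0_integral_distribution//.
    apply/measurable_EFinP; apply: measurable_mdist => //; exact: measurable_F.
  by move=> y; rewrite lee_fin mdist_ge0.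
(* a potential that is finite at one point is finite everywhere *)
have GXfin (x : X) : \int[distribution P (X_ 1%N)]_x' (mdist x (x' : X))%:E \is a fin_num.
  have [w Gw] : exists w, G_X1 (X_ 1%N) (X_ 1%N w) < +oo.
    apply: (expeR_moment_finite_point a_gt0 p_ge1 _ X1_moment) => w.
    by apply: integral_ge0 => x' _; rewrite lee_fin mdist_ge0.
  have := @potential_finite R X sepX (distribution P (X_ 1%N)) 1%R (X_ 1%N w) ler01.
  under eq_integral => x' _ do rewrite mul1r.
  move=> /(_ Gw x); under eq_integral => x' _ do rewrite mul1r.
  by [].
have Gefin (y : Y) : \int[P_e]_y' (C * mdist y (y' : Y))%:E \is a fin_num.
  have [w Gw] : exists w, G_eps C (eps 1%N) (eps 1%N w) < +oo.
    apply: (expeR_moment_finite_point a_gt0 p_ge1 _ eps_moment) => w.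
    by apply: integral_ge0 => x' _; rewrite lee_fin mulr_ge0 ?mdist_ge0// ltW.
  exact: (potential_finite sepY (ltW C_gt0) Gw).
have [GX GXE] : exists GX : X -> R, forall x,
    \int[distribution P (X_ 1%N)]_x' (mdist x (x' : X))%:E = (GX x)%:E.
  by eexists => x; rewrite -[LHS]fineK.
have [Ge GeE] : exists Ge : Y -> R, forall y,
    \int[P_e]_y' (C * mdist y (y' : Y))%:E = (Ge y)%:E.
  by eexists => y; rewrite -[LHS]fineK.
have GX0 x : (0 <= GX x)%R.
  by rewrite -lee_fin -GXE; apply: integral_ge0 => x' _; rewrite lee_fin mdist_ge0.
have Ge0 y : (0 <= Ge y)%R.
  by rewrite -lee_fin -GeE; apply: integral_ge0 => y' _; rewrite lee_fin mulr_ge0 ?mdist_ge0// ltW.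
have mGX : measurable_fun setT (GX : borel X -> R) by exact: (measurable_GX sepX GXE).
have mGe : measurable_fun setT (Ge : borel Y -> R) by exact: (measurable_Ge sepY C_gt0 GeE).
pose M := Num.max K1 K2.
have M_ge1 : (1 <= M)%R by rewrite le_max K1_ge1.
have M_gt0 : (0 < M)%R by exact: lt_le_trans M_ge1.
have X1_mom : \int[P]_w (expR (a * GX (X_ 1%N w) `^ p))%:E <= M%:E.
  apply: (@le_trans _ _ K1%:E); last by rewrite lee_fin le_max lexx.
  by apply: le_trans X1_moment; under [leRHS]eq_integral => w _ do rewrite /G_X1 GXE.
have eps_mom : \int[P]_w (expR (a * Ge (eps 1%N w) `^ p))%:E <= M%:E.
  apply: (@le_trans _ _ K2%:E); last by rewrite lee_fin le_max lexx orbT.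
  by apply: le_trans eps_moment; under [leRHS]eq_integral => w _ do rewrite /G_eps GeE.
(* b and alpha undo the factor L between a potential and the bound of the
   corresponding increment *)
pose L := ((1 - rho)^-1)%R.
have L_gt0 : (0 < L)%R by rewrite invr_gt0 subr_gt0.
pose b := (a / L)%R; have b_gt0 : (0 < b)%R by rewrite divr_gt0.
pose K := (expR a * M)%R; have K_gt0 : (0 < K)%R by rewrite mulr_gt0 ?expR_gt0.
pose c := (16 / b ^+ 2 * K)%R; have c_gt0 : (0 < c)%R.
  by rewrite mulr_gt0// divr_gt0// exprn_gt0.
have bL g : (b * (L * g) = a * g)%R by rewrite /b; field; rewrite gt_eqF.
have X1_exp : \int[P]_w (expR (b * (L * GX (X_ 1%N w))))%:E <= K%:E.
  under eq_integral => w _ do rewrite bL.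
  apply: (@exp_moment_linear R d Omega P (fun w => GX (X_ 1%N w)) a p M a_gt0 p_ge1 _ _ X1_mom).
    by move=> w; exact: GX0.
  exact: (measurableT_comp mGX).
have eps_exp : \int[P_e]_y (expR (b * (L * Ge y)))%:E <= K%:E.
  under eq_integral => y _ do rewrite bL.
  rewrite ge0_integral_distribution//; last 1 first.
    by apply/measurable_EFinP; apply: measurableT_comp => //; exact: measurable_funM.
  apply: (@exp_moment_linear R d Omega P (fun w => Ge (eps 1%N w)) a p M a_gt0 p_ge1 _ _ eps_mom).
    by move=> w; exact: Ge0.
  exact: (measurableT_comp mGe).
pose alpha := (a / L `^ p)%R.
have Lp_gt0 : (0 < L `^ p)%R by exact: powR_gt0.
have alpha_gt0 : (0 < alpha)%R by rewrite divr_gt0.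
have alphaL g : (0 <= g)%R -> (alpha * (L * g) `^ p = a * g `^ p)%R.
  by move=> g0; rewrite powRM// ?(ltW L_gt0)// /alpha; field; rewrite gt_eqF.
(* C0 <= x ensures both 1 <= x and ln M <= alpha / 2 * x ^ p *)
pose C0 := Num.max 1%R (2 * ln M / alpha)%R.
have C0_ge1 : (1 <= C0)%R by rewrite le_max lexx.
have C0_gt0 : (0 < C0)%R by exact: lt_le_trans C0_ge1.
(* Chernoff's bound is used at t = theta * x: the first term of the minimum
   keeps half of the linear exponent, the second keeps t below b / 2 *)
pose theta := Num.min ((2 * c)^-1)%R (b / (2 * C0))%R.
have theta_gt0 : (0 < theta)%R.
  by rewrite lt_min invr_gt0 mulr_gt0//= divr_gt0// mulr_gt0.
exists (alpha / 2)%R, (theta / 2)%R, C0; split => //; [by rewrite divr_gt0..|].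
case=> // k x _.
have muV : \int[mu]_z (mdist (point : X) (z : X))%:E < +oo.
  apply: (invariant_first_moment sepX F_meas mu_inv rho_ge0 rho_lt1 contract).
  pose y0 := (point : Y).
  apply: (@le_lt_trans _ _ (\int[P_e]_y
    ((mdist (point : X) (F (point, y0) : X))%:E + (C * mdist y0 (y : Y))%:E))).
    apply: ge0_le_integral => //.
    - by move=> y _; rewrite lee_fin mdist_ge0.
    - by apply/measurable_EFinP; apply: measurable_mdist => //; exact: measurable_F.
    - apply: emeasurable_funD => //; apply/measurable_EFinP; apply: measurable_funM => //.
      exact: measurable_mdist.
    - move=> y _; rewrite -EFinD lee_fin.
      by apply: le_trans (metric_triangle _ (F (point, y0) : X) _) _; rewrite lerD2l.
  rewrite ge0_integralD//; last 3 first.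
  - by move=> y _; rewrite lee_fin mdist_ge0.
  - by move=> y _; rewrite lee_fin mulr_ge0 ?mdist_ge0// ltW.
  - by apply/measurable_EFinP; apply: measurable_funM => //; exact: measurable_mdist.
  by rewrite integral_cst//= probability_setT mule1 GeE -EFinD ltry.
pose n := k.+1.
pose emp (z : nat -> X) := empirical_measure n (z : nat -> borel X).
have W1fin z : W1 (emp z) mu \is a fin_num by exact: (W1_finite sepX _ _ muV).
pose f (z : nat -> X) := (n%:R * fine (W1 (emp z) mu))%R.
have n_gt0 : (0 < n%:R :> R)%R by rewrite ltr0n.
have fle z z' : (f z - f z' <= \sum_(i < n) mdist (z i.+1) (z' i.+1))%R.
  have := @W1_lipschitz R X sepX mu n z' z isT.
  rewrite -/(emp z) -/(emp z') -(fineK (W1fin z)) -(fineK (W1fin z')) -EFinD lee_fin.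
  rewrite -(ler_pM2l n_gt0) mulrDr mulrA mulfV ?gt_eqF// mul1r /f; lra.
have f_lip : path_lipschitz rho k f.
  move=> z z'; rewrite -/L.
  have fle' : (`|f z - f z'| <= \sum_(i < n) mdist (z i.+1) (z' i.+1))%R.
    rewrite ler_norml; apply/andP; split; last exact: fle.
    rewrite lerNl opprB; apply: le_trans (fle z' z) _.
    by apply: ler_sum => i _; rewrite metric_sym.
  apply: le_trans fle' _; rewrite big_ord_recr /= lerD2l ler_peMl ?mdist_ge0//.
  by rewrite /L invf_ge1 ?subr_gt0// lerBlDr lerDl.
have [m0 [fint fmean fbound fmgf]] := chain_concentration sepX sepY eps_iid X1_indep
  F_meas X_chain rho_ge0 rho_lt1 C_gt0 contract F_lip GXE GeE b_gt0 X1_exp eps_exp f_lip.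
pose path w := (fun i => X_ i w : X).
pose S w := (f (path w) - m0)%R.
have mS : measurable_fun setT S.
  apply: measurable_funB => //; apply/measurable_EFinP; exact: (measurable_int _ fint).
have devE : [set w | x%:E < W1_deviation X_ mu n w] = [set w | (n%:R * x < `|S w|)%R].
  have W1E w : W1 (empirical_measure n (fun i => X_ i w)) mu = (n%:R^-1 * f (path w))%:E.
    by rewrite /f mulKf ?gt_eqF// fineK// W1fin.
  have meanE : mean_W1 X_ mu n = (n%:R^-1 * m0)%:E.
    rewrite /mean_W1; under eq_integral => w _ do rewrite W1E EFinM.
    by rewrite integralZl// fmean.
  apply/seteqP; split => w /=; rewrite /W1_deviation W1E meanE -EFinB lte_fin -mulrBr;
    by rewrite normrM gtr0_norm ?invr_gt0// [X in (x < X)%R]mulrC ltr_pdivlMr// mulrC.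
rewrite devE; split => [C0x|/andP[x0 xC0]].
- have x_ge1 : (1 <= x)%R by exact: le_trans C0x.
  have x_gt0 : (0 < x)%R by exact: lt_le_trans x_ge1.
  pose H := increment_bound eps X_ rho GX Ge.
  apply: (@le_trans _ _ (expR (- (n%:R * (alpha / 2) * x `^ p)))%:E); last first.
    by rewrite lee_fin ler_peMl ?expR_ge0// ler1n.
  apply: (@power_regime R _ Omega P n S mS H p alpha M x) => //.
  + have : (2 * ln M / alpha <= x `^ p)%R.
      apply: le_trans (le1r_powR x_ge1 p_ge1); apply: le_trans C0x.
      by rewrite le_max lexx orbT.
    by rewrite ler_pdivrMr//; lra.
  + case=> [|i] /=; apply: measurable_funM => //.
      exact: (measurableT_comp mGX).
    exact: (measurableT_comp mGe).
  + by case=> [|i] w /=; rewrite mulr_ge0// ltW.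
  + under eq_integral => w _.
      rewrite big_ord_recl mulrDr mulr_sumr /=; over.
    apply: (@exp_sum_moment _ _ _ _ _ _ _ _ _ eps_iid X1_indep F_meas X_chain
      (fun x => alpha * (L * GX x) `^ p)%R (fun y => alpha * (L * Ge y) `^ p)%R M).
    * apply: measurable_funM => //; apply: (measurableT_comp (measurable_powR p)).
      exact: measurable_funM.
    * apply: measurable_funM => //; apply: (measurableT_comp (measurable_powR p)).
      exact: measurable_funM.
    * exact: ltW.
    * under eq_integral => w _ do rewrite (alphaL _ (GX0 _)).
      exact: X1_mom.
    * under eq_integral => y _ do rewrite (alphaL _ (Ge0 _)).
      rewrite ge0_integral_distribution; [exact: eps_mom| |].
        apply/measurable_EFinP; apply: measurableT_comp => //; apply: measurable_funM => //.
        exact: (measurableT_comp (measurable_powR p)).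
      by move=> y; rewrite lee_fin expR_ge0.
- have tx0 : (0 <= theta * x)%R by rewrite mulr_ge0// ltW.
  have txb : (theta * x <= b / 2)%R.
    apply: (@le_trans _ _ (b / (2 * C0) * C0)%R).
      by rewrite ler_pM// ?(ltW theta_gt0)// ge_min lexx orbT.
    rewrite le_eqVlt; apply/orP; left; apply/eqP; field; rewrite gt_eqF//.
  have mgf t : (`|t| <= theta * x)%R ->
      \int[P]_w (expR (t * S w))%:E <= (expR (n%:R * (c * t ^+ 2)))%:E.
    by move=> tx; apply: fmgf; exact: le_trans txb.
  apply: (le_trans (@chernoff R d Omega P n S mS c (theta * x) x tx0 mgf)).
  rewrite lee_fin ler_pM2l// ler_expR lerN2 -mulrA ler_pM2l//.
  have theta_c : (theta * c <= 1 / 2)%R.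
    apply: (@le_trans _ _ ((2 * c)^-1 * c)%R).
      by rewrite ler_pM2r// ge_min lexx.
    by rewrite le_eqVlt; apply/orP; left; apply/eqP; field; rewrite gt_eqF.
  have : (0 <= (1 / 2 - theta * c) * (theta * x ^+ 2))%R.
    by rewrite mulr_ge0 ?subr_ge0// mulr_ge0 ?sqr_ge0// ltW.
  by rewrite !expr2; lra.
Qed.
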